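(* Let $d\in\{2,3\}$, let $\omega,\hat\omega$ be kernels satisfying the kernel assumptions (K1)–(K4) stated in the context, and let $\delta>0$. Then, in the sense of distributions over the periodic cell $\Omega=(-\pi,\pi)^d$, a $2\pi$-periodic square integrable vector field $\bm u$ satisfies $\nabla\cdot\bm u\equiv0$ if and only if $\mathcal D_\delta\bm u\equiv0$. In other words, $$\{\bm u\in [L^2(\Omega)]^d:\nabla\cdot\bm u\equiv0\text{ in }\Omega\}=\{\bm u\in [L^2(\Omega)]^d:\mathcal D_\delta\bm u\equiv0\text{ in }\Omega\}.$$
   Context: Functions on $\Omega=(-\pi,\pi)^d$ are $2\pi$-periodic, with Fourier coefficients $\widehat g(\bm\xi)=\int_\Omega g(\bm x)e^{-i\bm\xi\cdot\bm x}d\bm x$, $\bm\xi\in\mathbb Z^d$. Kernels. $\omega,\hat\omega:(0,\infty)\to[0,\infty)$ are measurable, vanish on $(1,\infty)$, and for $\delta>0$ one sets $\underline\omega_\delta(r)=\delta^{-(d+2)}\omega(r/\delta)$, $\hat\omega_\delta(r)=\delta^{-(d+1)}\hat\omega(r/\delta)$. Assumptions: (K1) $\frac12\int_{\mathbb R^d}\underline\omega_\delta(|\bm x|)|\bm x|^2d\bm x=d$; (K2) $\int_{\mathbb R^d}\hat\omega_\delta(|\bm x|)|\bm x|d\bm x=d$; (K3) $r^{d-1}\hat\omega(r)$ is nonincreasing for $r\in(0,1)$; (K4) there are $\epsilon\in(0,1]$, $c>0$ and $\beta\in(-1,1)$ with $\hat\omega(r)=c\,r^{-d-\beta}$ for $r\in(0,\epsilon)$.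 Nonlocal divergence: $\mathcal D_\delta\bm u(\bm x)=\int_{\mathbb R^d}\vec\omega_\delta(\bm y-\bm x)\cdot(\bm u(\bm y)+\bm u(\bm x))d\bm y$ with $\vec\omega_\delta(\bm x)=\hat\omega_\delta(|\bm x|)\bm x/|\bm x|$ (principal value where needed). In Fourier variables it acts, and is extended to periodic distributions, by $\widehat{\mathcal D_\delta\bm u}(\bm\xi)=i\,\bm b_\delta(\bm\xi)^T\widehat{\bm u}(\bm\xi)$, where $\bm b_\delta(\bm\xi)=\int_{|\bm s|\le\delta}\hat\omega_\delta(|\bm s|)\frac{\bm s}{|\bm s|}\sin(\bm\xi\cdot\bm s)d\bm s$. *)

(* Defs.v *)
From HB Require Import structures.
From mathcomp Require Import all_boot all_order all_algebra.
From mathcomp Require Import all_classical all_reals all_analysis.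
From mathcomp Require Import complex.

Set Implicit Arguments.
Unset Strict Implicit.
Unset Printing Implicit Defensive.

Import Order.TTheory GRing.Theory Num.Theory.
Import numFieldNormedType.Exports.

Local Open Scope classical_set_scope.
Local Open Scope ring_scope.

Fact rV_display : measure_display.
Proof. exact. Qed.

(* The sigma-algebra generated by the coordinates, i.e. the Borel sets
   of R^n. *)
Section measurable_rV.
Context (R : realType) (n : nat).

Let coord (i : 'I_n) (x : 'rV[R]_n) : measurableTypeR R := x ord0 i.

Let rV_set0 : g_sigma_preimage coord set0.
Proof. exact: sigma_algebra0. Qed.

Let rV_setC A : g_sigma_preimage coord A -> g_sigma_preimage coord (~` A).
Proof. exact: sigma_algebraC. Qed.

Let rV_bigcup (F : (set 'rV[R]_n)^nat) :
  (forall i, g_sigma_preimage coord (F i)) ->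
  g_sigma_preimage coord (\bigcup_i (F i)).
Proof. exact: sigma_algebra_bigcup. Qed.

HB.instance Definition _ := @isMeasurable.Build rV_display
  'rV[R]_n (g_sigma_preimage coord) rV_set0 rV_setC rV_bigcup.

End measurable_rV.

Section measurable_fun_rV.
Context (R : realType).

Lemma measurable_coord n (i : 'I_n) :
  measurable_fun [set: 'rV[R]_n] (fun x => x ord0 i : measurableTypeR R).
Proof.
move=> _ Y mY; rewrite setTI; apply: sub_sigma_algebra => /=.
rewrite -bigcup_seq/=; exists i => /=; first by rewrite mem_index_enum.
by exists Y => //; rewrite setTI.
Qed.

Lemma measurable_fun_rV d (T : measurableType d) n (f : T -> 'rV[R]_n) :
  (forall i, measurable_fun [set: T] (fun t => f t ord0 i : measurableTypeR R)) ->
  measurable_fun [set: T] f.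
Proof.
move=> mf; pose c (i : 'I_n) (x : 'rV[R]_n) : measurableTypeR R := x ord0 i.
suff prefS : g_sigma_preimage (fun i => c i \o f) `<=` measurable.
  move=> _ A mA; apply: prefS; rewrite g_sigma_preimage_comp.
  by exists A.
apply: smallest_sub; first exact: sigma_algebra_measurable.
rewrite -bigcup_seq/=; apply: bigcup_sub => i _ A [B mB <-]; exact: mf.
Qed.

Definition rV_cons n (p : measurableTypeR R * 'rV[R]_n) : 'rV[R]_n.+1 :=
  row_mx (p.1%:M : 'rV[R]_1) p.2.

Definition rV_uncons n (x : 'rV[R]_n.+1) : measurableTypeR R * 'rV[R]_n :=
  (x ord0 ord0, \row_j x ord0 (lift ord0 j)).

Lemma rV_cons0 n p : @rV_cons n p ord0 ord0 = p.1.
Proof.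
rewrite (_ : (ord0 : 'I_n.+1) = lshift n (ord0 : 'I_1)); last exact: val_inj.
by apply: etrans (row_mxEl _ _ _ _) _; rewrite mxE eqxx.
Qed.

Lemma rV_consS n p j : @rV_cons n p ord0 (lift ord0 j) = p.2 ord0 j.
Proof.
rewrite (_ : lift ord0 j = rshift 1 j); last exact: val_inj.
exact: row_mxEr.
Qed.

Lemma rV_consK n : cancel (@rV_cons n) (@rV_uncons n).
Proof.
move=> [a v]; rewrite /rV_uncons rV_cons0; congr pair.
by apply/rowP => j; rewrite mxE rV_consS.
Qed.

Lemma measurable_rV_cons n : measurable_fun setT (@rV_cons n).
Proof.
apply: measurable_fun_rV => i; have [j ->|->] := unliftP ord0 i.
- under eq_fun do rewrite rV_consS.
  exact: (measurableT_comp (@measurable_coord n j) measurable_snd).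
- rewrite (_ : (fun t => _) = fst); first exact: measurable_fst.
  by apply/funext => t; rewrite rV_cons0.
Qed.

Lemma measurable_rV_uncons n : measurable_fun setT (@rV_uncons n).
Proof.
apply/measurable_fun_pairP; split; first exact: measurable_coord.
apply: measurable_fun_rV => i.
rewrite (_ : (fun t => _) = fun t : 'rV[R]_n.+1 => t ord0 (lift ord0 i)).
  exact: measurable_coord.
by apply/funext => t; rewrite mxE.
Qed.

End measurable_fun_rV.

Section leb_step.
Local Open Scope ereal_scope.
Context (R : realType) (n : nat).
Variable m : {sigma_finite_measure set 'rV[R]_n -> \bar R}.

Definition leb_step : set 'rV[R]_n.+1 -> \bar R :=
  pushforward (@lebesgue_measure R \x m) (@rV_cons R n).

Let step0 : leb_step set0 = 0.
Proof. by rewrite /leb_step /pushforward preimage_set0 measure0. Qed.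

Let step_ge0 A : 0 <= leb_step A.
Proof. by rewrite /leb_step /pushforward measure_ge0. Qed.

Let step_sigma_additive : semi_sigma_additive leb_step.
Proof.
move=> F mF tF mUF; rewrite /leb_step /pushforward preimage_bigcup.
apply: measure_semi_sigma_additive.
- move=> k; rewrite -[X in measurable X]setTI; exact: measurable_rV_cons.
- apply/trivIsetP => /= i j _ _ ij; rewrite -preimage_setI.
  by move/trivIsetP : tF => /(_ _ _ _ _ ij) ->//; rewrite preimage_set0.
- rewrite -preimage_bigcup -[X in measurable X]setTI.
  exact: measurable_rV_cons.
Qed.

HB.instance Definition _ := isMeasure.Build _ _ _
  leb_step step0 step_ge0 step_sigma_additive.

Let step_sigma_finite : sigma_finite setT leb_step.
Proof.
have /sigma_finiteP[F [FT Fnd Foo]] := @sigma_finiteT _ _ _ (@lebesgue_measure R).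
have /sigma_finiteP[G [GT Gnd Goo]] := sigma_finiteT m.
exists (fun k => @rV_uncons R n @^-1` (F k `*` G k)).
  apply/esym; rewrite -subTset => x _.
  have : setT (rV_uncons x).1 by []. rewrite FT => -[i _ Fi].
  have : setT (rV_uncons x).2 by []. rewrite GT => -[j _ Gj].
  exists (maxn i j) => //; split.
    have /subsetPset := Fnd _ _ (leq_maxl i j); exact.
  have /subsetPset := Gnd _ _ (leq_maxr i j); exact.
move=> k; have [mF Fk] := Foo k; have [mG Gk] := Goo k; split.
  rewrite -[X in measurable X]setTI; apply: measurable_rV_uncons => //.
  exact: measurableX.
rewrite /leb_step /pushforward -comp_preimage.
rewrite (_ : _ \o _ = id); last by apply/funext => p /=; rewrite rV_consK.
rewrite preimage_id product_measure1E// lte_mul_pinfty//.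
by rewrite ge0_fin_numE.
Qed.

HB.instance Definition _ := Measure_isSigmaFinite.Build _ _ _
  leb_step step_sigma_finite.

End leb_step.

(* Lebesgue measure on R^n: the n-fold product of the one-dimensional one,
   transported along R * R^n -> R^(n+1). *)
Fixpoint leb (R : realType) (n : nat) :
    {sigma_finite_measure set 'rV[R]_n -> \bar R} :=
  match n with
  | 0 => \d_ (0 : 'rV[R]_0)
  | m.+1 => leb_step (leb R m)
  end.

Section vectors.
Context (R : realType) (d : nat).
Implicit Types x y : 'rV[R]_d.

Definition dotp x y : R := \sum_(j < d) x ord0 j * y ord0 j.

(* The canonical norm of 'rV[R]_d is the sup norm. *)
Definition enorm x : R := Num.sqrt (dotp x x).

Definition freq (k : 'rV[int]_d) : 'rV[R]_d := map_mx (fun z => z%:~R) k.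

Definition cell : set 'rV[R]_d := [set x | forall j, - pi < x ord0 j < pi].

Definition periodic (T : Type) (f : 'rV[R]_d -> T) : Prop :=
  forall (k : 'rV[int]_d) x, f (x + (2 * pi) *: freq k) = f x.

Definition partial (j : 'I_d) (f : 'rV[R]_d -> R) : 'rV[R]_d -> R :=
  fun x => 'D_(delta_mx ord0 j) f x.

Definition smooth (f : 'rV[R]_d -> R) : Prop :=
  forall s : seq 'I_d, let g := foldr partial f s in
    continuous g /\ forall (j : 'I_d) x, derivable g x (delta_mx ord0 j).

Definition test_function (f : 'rV[R]_d -> R) : Prop := smooth f /\ periodic f.

(* A representative, defined and 2 pi-periodic on the whole of R^d, of an
   element of [L^2(cell)]^d. *)
Definition periodic_L2 (u : 'rV[R]_d -> 'rV[R]_d) : Prop :=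
  periodic u /\ forall j : 'I_d,
    measurable_fun [set: 'rV[R]_d] (fun x => u x ord0 j : measurableTypeR R) /\
    (\int[leb R d]_(x in cell) ((u x ord0 j) ^+ 2)%:E < +oo)%E.

End vectors.
Arguments freq {R d} k.
Arguments cell : clear implicits.

Section fourier.
Context (R : realType) (d : nat).
Local Open Scope complex_scope.

Definition cis (t : R) : R[i] := cos t +i* sin t.

Definition cintegral (D : set 'rV[R]_d) (f : 'rV[R]_d -> R[i]) : R[i] :=
  (\int[leb R d]_(x in D) complex.Re (f x)) +i*
  (\int[leb R d]_(x in D) complex.Im (f x)).

Definition fourier (g : 'rV[R]_d -> R) (xi : 'rV[int]_d) : R[i] :=
  cintegral (cell R d) (fun x => (g x)%:C * cis (- dotp (freq xi) x)).

Definition box_sum (F : 'rV[int]_d -> R[i]) (N : nat) : R[i] :=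
  \sum_(k : 'rV['I_N.*2.+1]_d)
    F (map_mx (fun i : 'I_N.*2.+1 => (i : nat)%:Z - N%:Z) k).

(* The sum over Z^d, as the limit of the sums over the cubes [-N, N]^d;
   it is meant for absolutely convergent families. *)
Definition lattice_sum (F : 'rV[int]_d -> R[i]) : R[i] :=
  limn (fun N => complex.Re (box_sum F N)) +i*
  limn (fun N => complex.Im (box_sum F N)).

End fourier.

Section divergences.
Context (R : realType) (d : nat).
Local Open Scope complex_scope.
Implicit Types (u : 'rV[R]_d -> 'rV[R]_d) (phi : 'rV[R]_d -> R).

Definition scaled_omega (omega : R -> R) (delta r : R) : R :=
  delta ^- d.+2 * omega (r / delta).

Definition scaled_omega_hat (omega_hat : R -> R) (delta r : R) : R :=
  delta ^- d.+1 * omega_hat (r / delta).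

(* A kernel (0, oo) -> [0, oo) is represented by a function on R whose values
   on (-oo, 0] are arbitrary and are never used, except at the single point
   r = 0, where they are multiplied by 0. *)
Definition is_kernel (w : R -> R) : Prop :=
  [/\ measurable_fun (`]0, +oo[ : set (measurableTypeR R))
        (w : measurableTypeR R -> measurableTypeR R),
      forall r, 0 < r -> 0 <= w r &
      forall r, 1 < r -> w r = 0].

Definition kernel_assumptions (omega omega_hat : R -> R) : Prop :=
  [/\ forall delta : R, 0 < delta ->
        ((2^-1)%:E * \int[leb R d]_x
           (scaled_omega omega delta (enorm x) * enorm x ^+ 2)%:E
         = d%:R%:E)%E,
      forall delta : R, 0 < delta ->
        (\int[leb R d]_x
           (scaled_omega_hat omega_hat delta (enorm x) * enorm x)%:E
         = d%:R%:E)%E,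
      forall r s : R, 0 < r -> r <= s -> s < 1 ->
        s ^+ d.-1 * omega_hat s <= r ^+ d.-1 * omega_hat r &
      exists eps c beta : R,
        [/\ 0 < eps <= 1, 0 < c, -1 < beta < 1 &
            forall r, 0 < r < eps -> omega_hat r = c * r `^ (- d%:R - beta)]].

(* The distributional divergence < div u, phi > = - \int u . grad phi. *)
Definition divergence u phi : R[i] :=
  (- \int[leb R d]_(x in cell R d)
       \sum_(j < d) u x ord0 j * partial j phi x)%:C.

Definition b_symbol (omega_hat : R -> R) (delta : R) (xi : 'rV[int]_d)
    (j : 'I_d) : R :=
  \int[leb R d]_(s in [set s | enorm s <= delta])
    (scaled_omega_hat omega_hat delta (enorm s) * (s ord0 j / enorm s) *
     sin (dotp (freq xi) s)).

Definition nonlocal_div_hat (omega_hat : R -> R) (delta : R) u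
    (xi : 'rV[int]_d) : R[i] :=
  (0 +i* 1) * \sum_(j < d) (b_symbol omega_hat delta xi j)%:C *
         fourier (fun x => u x ord0 j) xi.

(* The periodic distribution with Fourier coefficients nonlocal_div_hat:
   < T, phi > = (2 pi)^-d \sum_xi T^(xi) phi^(-xi). *)
Definition nonlocal_div (omega_hat : R -> R) (delta : R) u phi : R[i] :=
  ((2 * pi) ^- d)%:C * lattice_sum (fun xi =>
    nonlocal_div_hat omega_hat delta u xi * fourier phi (- xi)).

Definition vanishes (T : ('rV[R]_d -> R) -> R[i]) : Prop :=
  forall phi, test_function phi -> T phi = 0.

End divergences.

(* Main.v *)
From HB Require Import structures.
Require Import Defs.
From mathcomp Require Import all_boot all_order all_algebra.
From mathcomp Require Import all_classical all_reals all_analysis.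
From mathcomp Require Import measurable_realfun complex.
From mathcomp Require Import ring lra.
Set Implicit Arguments.
Unset Strict Implicit.
Unset Printing Implicit Defensive.
Import Order.TTheory GRing.Theory Num.Theory.
Import numFieldNormedType.Exports.
Local Open Scope classical_set_scope.
Local Open Scope ring_scope.

(** Both conditions on [u] are read off its Fourier coefficients: each of them
    holds if and only if the coefficient of [u] at every frequency [k] is
    orthogonal to [k].  This common condition is [spectral_divfree], written
    with the real waves [sin (k . x + t)] instead of complex exponentials.

    For the nonlocal divergence the heart of the matter is that the symbol is
    [b(k) = l k] with [l] nonzero whenever [k] is ([b_symbol_direction]).
    - [b(k)] is parallel to [k] ([symbol_parallel]): the integrand of
      [k_j b_i - k_i b_j] is odd under the reflection along
      [k_j e_i - k_i e_j], which fixes [k], preserves the norm, and preserves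
      Lebesgue measure because it is a product of three shears.
    - [k . b(k) > 0] ([symbol_positive]): in the coordinates [s = r (1, v)] the
      Jacobian is a power of [r], and on each line [v = const] the integral
      becomes a positive multiple of the integral over [r > 0] of
      [h r * sin (a r)], where [h] is nonincreasing because [r^(d-1) w(r)] is,
      and strictly decreasing near 0 because of the power law.  Each half-period
      on which the sine is negative is outweighed by the preceding one
      ([decreasing_sine]).  These coordinates play the role of polar ones, but
      need no surface measure: scaling and Fubini suffice, and the direction of
      [k] is arbitrary, so that no rotation is needed either.

    For the local divergence, testing against waves gives the spectral
    condition.  Conversely ([spectral_divergence]) the gradient of a test
    function [phi] is the bounded pointwise limit of its Fejer means.
    Integrating by parts, the means of [partial j phi] are combinations of waves
    with coefficients proportional to [k_j], so that they pair to 0 with [u];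
    dominated convergence concludes.  The Fejer means converge by a Korovkin
    argument ([fejer_mean_close]): it is enough to integrate the kernel against
    the constants and against the cosines of the coordinates.

    For the nonlocal one, pairing with a wave of frequency [k] only sees the
    coefficients at [k] and [-k] ([lattice_sum_pair]), and two phases of the
    wave separate them. *)

(** * Integration of real functions and positivity *)

Section Rintegral_sum.
Context d (T : measurableType d) (R : realType) (mu : {measure set T -> \bar R}).
Variables (D : set T) (mD : measurable D) (I : Type) (s : seq I) (F : I -> T -> R).
Hypothesis intF : forall i, mu.-integrable D (EFin \o F i).

Lemma integrable_Rsum : mu.-integrable D (EFin \o (fun x => \sum_(i <- s) F i x)).
Proof.
rewrite (_ : _ \o _ = fun x => (\sum_(i <- s) (F i x)%:E)%E); last first.
  by apply/funext => x /=; rewrite -sumEFin.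
by apply: (integrable_sum mD) => i _; exact: intF.
Qed.

Lemma Rintegral_sum :
  \int[mu]_(x in D) (\sum_(i <- s) F i x) = \sum_(i <- s) \int[mu]_(x in D) F i x.
Proof.
rewrite /Rintegral; under eq_integral do rewrite -sumEFin.
rewrite integral_sum// sum_fine// => i _.
exact: (integrable_fin_num mD (intF i)).
Qed.

End Rintegral_sum.

Lemma integral0_pos_neg d (T : measurableType d) (R : realType)
    (m : {measure set T -> \bar R}) (A : T -> \bar R) :
  m.-integrable setT A -> (\int[m]_x A x = 0)%E ->
  (\int[m]_x A^\+ x = \int[m]_x A^\- x)%E.
Proof.
move=> iA; rewrite integralE => A0.
have nfin := integrable_neg_fin_num measurableT iA.
by rewrite -[LHS](subeK _ nfin) A0 add0e.
Qed.

Section positivity.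
Local Open Scope ereal_scope.
Context d (T : measurableType d) (R : realType) (mu : {measure set T -> \bar R}).

Lemma ge0_integral_eq0_ae (f : T -> \bar R) : measurable_fun setT f ->
  (forall x, 0 <= f x) -> \int[mu]_x f x = 0 -> mu.-negligible [set x | f x != 0].
Proof.
move=> mf f0 i0; have /(ae_eq_integral_abs mu measurableT mf) : \int[mu]_x `|f x| = 0.
  by under eq_integral do rewrite gee0_abs//.
by apply: negligibleS => x /= /eqP fx H; apply: fx; exact: H.
Qed.

Lemma integral_gt0 (f : T -> \bar R) (A : set T) : measurable_fun setT f ->
  (forall x, 0 <= f x) -> measurable A -> mu A != 0 ->
  (forall x, A x -> 0 < f x) -> 0 < \int[mu]_x f x.
Proof.
move=> mf f0 mA A0 fA; rewrite lt0e integral_ge0// andbT.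
apply: contra_neq A0 => /(ge0_integral_eq0_ae mf f0) /negligibleS N.
apply: (@measure_negligible _ _ _ mu) => //.
by apply: N => x /fA; rewrite lt0e => /andP[].
Qed.

(** Strictness is only asked where [f] is finite: the Fubini slices to which
    this applies may be infinite on a negligible set. *)
Lemma ge0_lt_integral (f g : T -> \bar R) (A : set T) :
  measurable_fun setT f -> measurable_fun setT g ->
  (forall x, 0 <= f x) -> (forall x, f x <= g x) ->
  \int[mu]_x g x < +oo -> measurable A -> mu A != 0 ->
  (forall x, A x -> f x \is a fin_num -> f x < g x) ->
  \int[mu]_x f x < \int[mu]_x g x.
Proof.
move=> mf mg f0 fg ioo mA A0 fgA.
have g0 x : 0 <= g x by exact: le_trans (fg x).
have ig : mu.-integrable setT g.
  apply/integrableP; split => //.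
  by under eq_integral do rewrite gee0_abs//.
have if_ : mu.-integrable setT f.
  apply: (le_integrable measurableT mf _ ig) => x _.
  by rewrite !gee0_abs.
have mgf : measurable_fun setT (g \- f) by exact: emeasurable_funB.
have fgle : \int[mu]_x f x <= \int[mu]_x g x by exact: ge0_le_integral.
rewrite lt_neqAle fgle andbT; apply: contra_neq A0 => efg.
have := integralB measurableT ig if_; rewrite efg subee; last first.
  exact: integrable_fin_num.
have gf0 x : f x \is a fin_num -> 0 <= g x - f x by move=> fx; rewrite sube_ge0 ?fx.
move=> H.
have : \int[mu]_x `|(g \- f) x| = 0.
  rewrite -H; apply: ae_eq_integral => //; first exact: measurableT_comp.
  apply: (@negligibleS _ _ _ mu _ _ _ (integrable_ae measurableT if_)) => x /=.
  by apply: contra_not => /(_ I) /gf0 ? _; rewrite gee0_abs.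
move=> /(ae_eq_integral_abs mu measurableT mgf) N2.
apply: (@measure_negligible _ _ _ mu) => //.
apply: (negligibleS _ (negligibleU (integrable_ae measurableT if_) N2)).
move=> x Ax /=; have [fx|/negP fx] := boolP (f x \is a fin_num); [right|left].
  move: (fgA _ Ax fx); rewrite -sube_gt0 => gt /(_ I) /= E.
  by rewrite E ltxx in gt.
by move=> /(_ I).
Qed.
End positivity.

(** * Lebesgue measure on row vectors *)

Section affine.
Context (R : realType).
Local Notation mu := (@lebesgue_measure R).

Section pushforward_affine.
Variables (a b : R) (a0 : a != 0).
Let aff (t : measurableTypeR R) : measurableTypeR R := a * t + b.

Lemma measurable_affine : measurable_fun [set: measurableTypeR R] aff.
Proof.
apply: measurable_funD; last exact: measurable_cst.
by apply: measurable_funM; [exact: measurable_cst|exact: measurable_id].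
Qed.

Let mu' : {measure set (measurableTypeR R) -> \bar R} :=
  mscale (NngNum (normr_ge0 a))
    (measure_function_pushforward__canonical__measure_function_Measure
       mu measurable_affine).

Let mu'E A : measurable A -> mu A = mu' A.
Proof.
apply: lebesgue_measure_unique => X [[c d] /= _ <-].
rewrite /mu' /mscale /pushforward /=.
have [ap|an] := ltrP 0 a.
  rewrite [X in (_ * lebesgue_measure X)%E](_ : _ = [set` `](c - b) / a, (d - b) / a]]); last first.
    apply/seteqP; split => x /=; rewrite !in_itv/= ltr_pdivrMr// ler_pdivlMr//;
    by rewrite /aff => /andP[? ?]; apply/andP; split; nra.
  rewrite !lebesgue_measure_itv/= !lte_fin gtr0_norm// ltr_pM2r ?invr_gt0//.
  rewrite ltrD2r; case: ifPn => _; last by rewrite mule0.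
  by rewrite -!EFinB -EFinM; congr EFin; field.
have {}an : a < 0 by rewrite lt_neqAle a0.
rewrite [X in (_ * lebesgue_measure X)%E](_ : _ = [set` `[(d - b) / a, (c - b) / a[]); last first.
  apply/seteqP; split => x /=; rewrite !in_itv/= ltr_ndivlMr// ler_ndivrMr//;
  by rewrite /aff => /andP[? ?]; apply/andP; split; nra.
rewrite !lebesgue_measure_itv/= !lte_fin ltr0_norm// ltr_nM2r ?invr_lt0//.
rewrite ltrD2r; case: ifPn => _; last by rewrite mule0.
by rewrite -!EFinB -EFinM; congr EFin; field.
Qed.

(** Both sides integrate [f] against measures that agree on half-open
    intervals, hence on all Borel sets. *)
Lemma ge0_integral_affine (f : measurableTypeR R -> \bar R) :
  measurable_fun setT f -> (forall t, 0 <= f t)%E ->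
  (\int[mu]_t f t = `|a|%:E * \int[mu]_t f (a * t + b)%R)%E.
Proof.
move=> mf f0; rewrite (eq_measure_integral mu'); last by move=> A mA _; exact: mu'E.
rewrite ge0_integral_mscale//; congr (_ * _)%E.
exact: (ge0_integral_pushforward measurable_affine mu measurableT mf (fun t _ => f0 t)).
Qed.

End pushforward_affine.
End affine.

Section slices.
Context (R : realType).
Local Notation mu := (@lebesgue_measure R).
Local Open Scope ereal_scope.

Definition upd n (i : 'I_n) (x : 'rV[R]_n) (t : R) : 'rV[R]_n :=
  \row_j (if j == i then t else x ord0 j).

Lemma updE n (i j : 'I_n) (x : 'rV[R]_n) t :
  upd i x t ord0 j = if j == i then t else x ord0 j.
Proof. by rewrite mxE. Qed.

Lemma rV_consE n (s : measurableTypeR R) (v : 'rV[R]_n) (i : 'I_n.+1) :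
  rV_cons (s, v) ord0 i = oapp (v ord0) s (unlift ord0 i).
Proof. by case: unliftP => [j|] ->; rewrite ?rV_cons0 ?rV_consS. Qed.

Lemma upd_cons0 n (s t : R) (v : 'rV[R]_n) :
  upd ord0 (rV_cons (s : measurableTypeR R, v)) t = rV_cons (t : measurableTypeR R, v).
Proof.
by apply/rowP => j; rewrite updE !rV_consE; case: unliftP => [k|] ->.
Qed.

Lemma upd_consS n (i : 'I_n) (s t : R) (v : 'rV[R]_n) :
  upd (lift ord0 i) (rV_cons (s : measurableTypeR R, v)) t =
  rV_cons (s : measurableTypeR R, upd i v t).
Proof.
apply/rowP => j; rewrite updE !rV_consE; case: unliftP => [k|] -> /=.
  by rewrite (inj_eq lift_inj) updE.
by [].
Qed.

Lemma ge0_integral_leb_cons n (f : 'rV[R]_n.+1 -> \bar R) :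
  measurable_fun setT f -> (forall x, 0 <= f x) ->
  \int[leb R n.+1]_x f x = \int[mu]_s \int[leb R n]_v f (rV_cons (s, v)).
Proof.
move=> mf f0; rewrite [LHS](ge0_integral_pushforward (@measurable_rV_cons R n) _
  measurableT mf (fun t _ => f0 t)) preimage_setT.
rewrite fubini_tonelli1 //; last by move=> x; exact: f0.
exact: (measurableT_comp mf (@measurable_rV_cons R n)).
Qed.

Lemma ge0_integral_leb_cons_swap n (f : 'rV[R]_n.+1 -> \bar R) :
  measurable_fun setT f -> (forall x, 0 <= f x) ->
  \int[leb R n.+1]_x f x = \int[leb R n]_v \int[mu]_s f (rV_cons (s, v)).
Proof.
move=> mf f0; rewrite [LHS](ge0_integral_pushforward (@measurable_rV_cons R n) _
  measurableT mf (fun t _ => f0 t)) preimage_setT.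
rewrite fubini_tonelli2 //; last by move=> x; exact: f0.
exact: (measurableT_comp mf (@measurable_rV_cons R n)).
Qed.

Lemma measurable_fun_leb_cons n (s : R) (f : 'rV[R]_n.+1 -> \bar R) :
  measurable_fun setT f ->
  measurable_fun setT (fun v => f (rV_cons (s : measurableTypeR R, v))).
Proof.
move=> mf; apply: (measurableT_comp mf).
apply: (measurableT_comp (@measurable_rV_cons R n)).
exact: measurable_pair1.
Qed.

(** Tonelli in an arbitrary coordinate, although [leb] is built by adding the
    coordinates one at a time at the front.  All that is proved about [leb]
    is reduced by it to the one-dimensional case. *)
Lemma eq_ge0_integral_slice n (i : 'I_n) (f g : 'rV[R]_n -> \bar R) :
  measurable_fun setT f -> measurable_fun setT g ->
  (forall x, 0 <= f x) -> (forall x, 0 <= g x) ->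
  (forall x, \int[mu]_t f (upd i x t) = \int[mu]_t g (upd i x t)) ->
  \int[leb R n]_x f x = \int[leb R n]_x g x.
Proof.
elim: n i f g => [[]//|n IH] i f g mf mg f0 g0 fg.
have [j ij|i0] := unliftP ord0 i; last first.
  rewrite (ge0_integral_leb_cons_swap mf f0) (ge0_integral_leb_cons_swap mg g0).
  apply: eq_integral => v _.
  have := fg (rV_cons (0%R : measurableTypeR R, v)); rewrite i0.
  by under eq_integral do rewrite upd_cons0; under [in X in _ = X -> _]eq_integral do rewrite upd_cons0.
rewrite (ge0_integral_leb_cons mf f0) (ge0_integral_leb_cons mg g0).
apply: eq_integral => s _.
apply: (IH j) => [| | | |v] //.
- exact: measurable_fun_leb_cons.
- exact: measurable_fun_leb_cons.
have := fg (rV_cons (s, v)); rewrite ij.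
by under eq_integral do rewrite upd_consS; under [in X in _ = X -> _]eq_integral do rewrite upd_consS.
Qed.

Lemma measurable_upd n (i : 'I_n) (x : 'rV[R]_n) :
  measurable_fun [set: measurableTypeR R] (fun t : measurableTypeR R => upd i x t).
Proof.
apply: measurable_fun_rV => j; under eq_fun do rewrite updE.
by case: (j == i); [exact: measurable_id|exact: measurable_cst].
Qed.

Lemma upd_upd n (i : 'I_n) (x : 'rV[R]_n) s t : upd i (upd i x s) t = upd i x t.
Proof. by apply/rowP => j; rewrite !updE; case: eqP. Qed.

Lemma measurable_upd_fun n (i : 'I_n) (l : 'rV[R]_n -> R) :
  measurable_fun setT (l : 'rV[R]_n -> measurableTypeR R) ->
  measurable_fun setT (fun x => upd i x (l x)).
Proof.
move=> ml; apply: measurable_fun_rV => j; under eq_fun do rewrite updE.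
by case: (j == i) => //; exact: measurable_coord.
Qed.

(** Along the [i]-th coordinate the map is affine of slope [a], since [l] does
    not depend on that coordinate. *)
Lemma ge0_integral_leb_shear n (i : 'I_n) (a : R) (l : 'rV[R]_n -> R)
    (f : 'rV[R]_n -> \bar R) : a != 0%R ->
  measurable_fun setT (l : 'rV[R]_n -> measurableTypeR R) ->
  (forall x t, l (upd i x t) = l x) ->
  measurable_fun setT f -> (forall x, 0 <= f x) ->
  \int[leb R n]_x f x =
  `|a|%:E * \int[leb R n]_x f (upd i x (a * x ord0 i + l x)%R).
Proof.
move=> a0 ml ul mf f0.
have mg : measurable_fun setT (fun x => f (upd i x (a * x ord0 i + l x)%R)).
  apply: (measurableT_comp mf); apply: measurable_upd_fun.
  apply: measurable_funD => //; apply: measurable_funM => //.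
  exact: measurable_coord.
rewrite -ge0_integralZl ?lee_fin//.
apply: (eq_ge0_integral_slice (i := i)) => //.
- exact: measurable_funeM.
- by move=> x; rewrite mule_ge0.
move=> x; rewrite (ge0_integral_affine (a := a) (l x))//; last first.
  exact: (measurableT_comp mf (measurable_upd i x)).
rewrite -ge0_integralZl ?lee_fin//; last first.
  apply: (measurableT_comp mf); apply: (measurableT_comp (measurable_upd i x)).
  exact: measurable_affine.
by apply: eq_integral => t _; rewrite upd_upd updE eqxx ul.
Qed.

End slices.

Section cone.
Context (R : realType).
Local Notation mu := (@lebesgue_measure R).
Local Open Scope ereal_scope.

Lemma measurable_scale n d (T : measurableType d) (r : T -> measurableTypeR R)
    (v : T -> 'rV[R]_n) : measurable_fun setT r -> measurable_fun setT v ->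
  measurable_fun setT (fun t => (r t : R) *: v t).
Proof.
move=> mr mv; apply: measurable_fun_rV => j.
under eq_fun do rewrite mxE; apply: measurable_funM => //.
exact: (measurableT_comp (@measurable_coord R n j) mv).
Qed.

Lemma measurable_cons n d (T : measurableType d) (r : T -> measurableTypeR R)
    (v : T -> 'rV[R]_n) : measurable_fun setT r -> measurable_fun setT v ->
  measurable_fun setT (fun t => rV_cons (r t, v t)).
Proof.
move=> mr mv; apply: (measurableT_comp (@measurable_rV_cons R n)).
exact: measurable_fun_pair.
Qed.

Lemma scale_cons n (r s : R) (v : 'rV[R]_n) :
  r *: rV_cons (s : measurableTypeR R, v) = rV_cons ((r * s)%R : measurableTypeR R, r *: v).
Proof.
by apply/rowP => j; rewrite mxE !rV_consE; case: unliftP => [k|] _ //=; rewrite mxE.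
Qed.

Lemma ge0_integral_leb_scale n (r : R) (f : 'rV[R]_n -> \bar R) : r != 0%R ->
  measurable_fun setT f -> (forall x, 0 <= f x) ->
  \int[leb R n]_x f x = (`|r| ^+ n)%:E * \int[leb R n]_x f (r *: x).
Proof.
move=> r0; elim: n f => [|n IH] f mf f0.
  rewrite expr0 mul1e; apply: eq_integral => x _; congr f.
  by apply/rowP => -[].
have mfr : measurable_fun setT (fun x : 'rV[R]_n.+1 => f (r *: x)).
  apply: (measurableT_comp mf); apply: measurable_scale => //.
rewrite (ge0_integral_leb_cons mf f0) (ge0_integral_leb_cons mfr (fun x => f0 _)).
have mc : measurable_fun setT (f \o (@rV_cons R n)).
  exact: (measurableT_comp mf (@measurable_rV_cons R n)).
have mF := measurable_fun_fubini_tonelli_F (m2 := leb R n) _ mc (fun x => f0 _).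
rewrite (ge0_integral_affine 0%R r0); last 2 first.
- exact: mF.
- by move=> t; apply: integral_ge0.
rewrite exprS EFinM -muleA; congr (_ * _).
rewrite -ge0_integralZl ?lee_fin ?exprn_ge0//; last 2 first.
- have mcr : measurable_fun setT ((fun x : 'rV[R]_n.+1 => f (r *: x)) \o (@rV_cons R n)).
    exact: (measurableT_comp mfr (@measurable_rV_cons R n)).
  exact: (measurable_fun_fubini_tonelli_F (m2 := leb R n) _ mcr (fun x => f0 _)).
- by move=> s _; apply: integral_ge0.
apply: eq_integral => s _.
rewrite (IH (fun v => f (rV_cons ((r * s + 0)%R : measurableTypeR R, v))))//.
  by congr (_ * _); apply: eq_integral => v _; rewrite scale_cons addr0.
exact: measurable_fun_leb_cons.
Qed.

Section cone_density.
Variables (n : nat) (f : 'rV[R]_n.+1 -> \bar R).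
Hypotheses (mf : measurable_fun setT f) (f0 : forall x, 0 <= f x).

Let g (p : measurableTypeR R * 'rV[R]_n) :=
  (`|p.1| ^+ n)%:E * f (p.1 *: rV_cons (1%R : measurableTypeR R, p.2)).

Let mg : measurable_fun setT g.
Proof.
apply: emeasurable_funM.
  apply/measurable_EFinP; apply: measurable_funX.
  exact: (measurableT_comp (@normr_measurable R setT) measurable_fst).
by apply: (measurableT_comp mf); apply: measurable_scale => //; apply: measurable_cons.
Qed.

Let g0 p : 0 <= g p.
Proof. by rewrite mule_ge0// lee_fin exprn_ge0. Qed.

Lemma measurable_fun_leb_cone : measurable_fun setT (fun v : 'rV[R]_n =>
  \int[mu]_r ((`|r| ^+ n)%:E * f (r *: rV_cons (1%R : measurableTypeR R, v)))).
Proof. exact: (measurable_fun_fubini_tonelli_G (m1 := mu) _ mg g0). Qed.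

(** Change of variables [s = r (1, v)]: for fixed first coordinate [r], the
    remaining ones are [r v], which produces the Jacobian [`|r| ^+ n].  The
    hyperplane [r = 0], where this degenerates, is negligible. *)
Lemma ge0_integral_leb_cone :
  \int[leb R n.+1]_x f x =
  \int[leb R n]_v \int[mu]_r ((`|r| ^+ n)%:E * f (r *: rV_cons (1%R : measurableTypeR R, v))).
Proof.
rewrite -(fubini_tonelli (m1 := mu) (m2 := leb R n) _ mg g0).
rewrite (ge0_integral_leb_cons mf f0).
have mc : measurable_fun setT (f \o (@rV_cons R n)).
  exact: (measurableT_comp mf (@measurable_rV_cons R n)).
apply: ge0_ae_eq_integral => //.
- exact: (measurable_fun_fubini_tonelli_F (m2 := leb R n) _ mc (fun x => f0 _)).
- exact: (measurable_fun_fubini_tonelli_F (m2 := leb R n) _ mg g0).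
- by move=> t _; apply: integral_ge0.
- by move=> t _; apply: integral_ge0 => v _; exact: (g0 (t, v)).
exists [set 0%R]; split; [by []|exact: lebesgue_measure_set1|].
move=> s /=; apply: contra_notP => /eqP s0 _.
rewrite (ge0_integral_leb_scale s0)//; last exact: measurable_fun_leb_cons.
rewrite -ge0_integralZl ?lee_fin//.
  by apply: eq_integral => v _; rewrite /g /= scale_cons mulr1.
apply: (measurableT_comp (measurable_fun_leb_cons s mf)).
exact: measurable_scale.
Qed.
End cone_density.
End cone.

(** * The sine integral of a decreasing function *)

Section decreasing_sine.
Context (R : realType).
Local Notation mu := (@lebesgue_measure R).
Local Open Scope ereal_scope.

(** A kernel has no meaning outside of the positive half-line; extending it by
    0 makes it measurable on the whole line. *)
Definition half_line (f : R -> R) (r : R) : R := if (0 < r)%R then f r else 0%R.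

Lemma measurable_half_line (f : R -> R) :
  measurable_fun setT (f : measurableTypeR R -> measurableTypeR R) ->
  measurable_fun setT (half_line f : measurableTypeR R -> measurableTypeR R).
Proof.
move=> mf; apply: measurable_fun_ifT => //.
by apply: measurable_fun_ltr => //; exact: measurable_cst.
Qed.

Lemma half_line_ge0 (f : R -> R) r : (forall r, 0 < r -> 0 <= f r)%R -> (0 <= half_line f r)%R.
Proof. by move=> f0; rewrite /half_line; case: ifPn => // /f0. Qed.

Lemma integral_norm_half_line (f : R -> R) :
  measurable_fun setT (f : measurableTypeR R -> measurableTypeR R) ->
  (forall r, 0 < r -> 0 <= f r)%R -> f 0%R = 0%R ->
  \int[mu]_r (f `|r|%R)%:E =
    \int[mu]_r (half_line f r)%:E + \int[mu]_r (half_line f r)%:E.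
Proof.
move=> mf f0 f00.
have mh := measurable_half_line mf.
have mhN : measurable_fun setT
    ((fun r => half_line f (-1 * r + 0)) : measurableTypeR R -> measurableTypeR R).
  exact: (measurableT_comp mh (@measurable_affine _ (-1)%R 0%R)).
rewrite [X in _ = _ + X](ge0_integral_affine (a := (-1)%R) 0%R)//; last 2 first.
- exact/measurable_EFinP.
- by move=> t; rewrite lee_fin half_line_ge0.
rewrite normrN1 mul1e -ge0_integralD//; last 4 first.
- by move=> t _; rewrite lee_fin half_line_ge0.
- exact/measurable_EFinP.
- by move=> t _; rewrite lee_fin half_line_ge0.
- exact/measurable_EFinP.
apply: eq_integral => r _; rewrite -EFinD addr0 mulN1r /half_line oppr_gt0.
have [r0|r0|<-] := ltrgtP 0%R (r : R).
- by rewrite addr0 gtr0_norm.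
- by rewrite add0r ltr0_norm.
- by rewrite addr0 normr0 f00.
Qed.

Lemma measurable_sin_affine (a b : R) :
  measurable_fun setT ((fun r => sin (a * r + b)) : measurableTypeR R -> measurableTypeR R).
Proof.
apply: (measurableT_comp _ (@measurable_affine _ a b)).
by apply: continuous_measurable_fun; exact: continuous_sin.
Qed.

(** [I 1] and [I (-1)] are the integrals of [h] against the positive and the
    negative part of the sine.  The negative part is the positive part shifted
    by the half-period [pi / a], and [h] decreases along this shift.  The two
    parts are kept apart because [I 1] may be infinite. *)
Lemma decreasing_sine (h : R -> R) (a eta : R) :
  measurable_fun setT (h : measurableTypeR R -> measurableTypeR R) ->
  (forall r, 0 < r -> 0 <= h r)%R ->
  (forall r s, 0 < r -> r <= s -> h s <= h r)%R ->
  (0 < a)%R -> (0 < eta)%R ->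
  (forall r, 0 < r < eta -> h (r + pi / a) < h r)%R ->
  let I s := \int[mu]_r (half_line (fun r => h r * Num.max 0 (s * sin (a * r)))%R r)%:E in
  I (-1)%R <= I 1%R /\ (I (-1)%R \is a fin_num -> I (-1)%R < I 1%R).
Proof.
move=> mh h0 hdec a0 eta0 hs I.
pose P := (pi / a)%R.
have P0 : (0 < P)%R by rewrite divr_gt0// pi_gt0.
have aP r : (a * (r + P) = a * r + pi)%R by rewrite /P; field; rewrite gt_eqF.
pose J r := half_line (fun r => (h r - h (r + P)) * Num.max 0 (1 * sin (a * r)))%R r.
have ms s : measurable_fun setT ((fun r => Num.max 0 (s * sin (a * r)))%R :
    measurableTypeR R -> measurableTypeR R).
  apply: measurable_maxr; first exact: measurable_cst.
  apply: measurable_funM; first exact: measurable_cst.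
  by under eq_fun do rewrite -[(a * _)%R]addr0; exact: measurable_sin_affine.
have mI s : measurable_fun setT
    (half_line (fun r => h r * Num.max 0 (s * sin (a * r)))%R : measurableTypeR R -> measurableTypeR R).
  by apply: measurable_half_line; exact: (measurable_funM mh (ms s)).
have mJ : measurable_fun setT (J : measurableTypeR R -> measurableTypeR R).
  apply: measurable_half_line; apply: (measurable_funM _ (ms 1%R)).
  apply: measurable_funB => //; apply: (measurableT_comp mh).
  by under eq_fun do rewrite -[X in (X + _)%R]mul1r; exact: measurable_affine.
have J0 r : (0 <= J r)%R.
  apply: half_line_ge0 => {}r r0; rewrite mulr_ge0// ?le_max ?lexx// subr_ge0.
  by rewrite hdec// lerDl ltW.
have I0 s r : (0 <= half_line (fun r => h r * Num.max 0 (s * sin (a * r)))%R r)%R.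
  by apply: half_line_ge0 => {}r r0; rewrite mulr_ge0 ?h0// le_max lexx.
(* [J] is what remains of the positive part after the shifted negative one. *)
have IJ : I 1%R = I (-1)%R + \int[mu]_r (J r)%:E.
  rewrite /I [X in _ = X + _](ge0_integral_affine P (oner_neq0 R)); last 2 first.
  - apply/measurable_EFinP.
    exact: (mI (-1)%R).
  - by move=> t; rewrite lee_fin.
  rewrite normr1 mul1e -ge0_integralD//; last 4 first.
  - by move=> t _; rewrite lee_fin.
  - apply/measurable_EFinP; exact: (measurableT_comp (mI (-1)%R) (@measurable_affine _ 1%R P)).
  - by move=> t _; rewrite lee_fin.
  - exact/measurable_EFinP.
  apply: eq_integral => r _; rewrite -EFinD; congr EFin.
  rewrite /J /half_line !mul1r aP sinDpi mulN1r opprK.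
  have [r0|r0] := ltrP 0 r; first by rewrite addr_gt0// mulrBl subrKC.
  rewrite addr0; case: ifPn => // rP; apply/esym/eqP; rewrite mulf_eq0; apply/orP; right.
  apply/eqP/max_idPl; rewrite -oppr_ge0 -sinDpi -aP sin_ge0_pi//.
  apply/andP; split; first by rewrite mulr_ge0 ?ltW.
  by rewrite aP -[in leRHS](add0r pi) lerD2r mulr_ge0_le0// ltW.
have Jgt0 : 0 < \int[mu]_r (J r)%:E.
  have e0 : (0 < Num.min eta P)%R by rewrite lt_min eta0.
  apply: (@integral_gt0 _ (measurableTypeR R) R mu (fun r => (J r)%:E) [set` `]0%R, Num.min eta P[]).
  - exact/measurable_EFinP.
  - by move=> r; rewrite lee_fin.
  - exact: measurable_itv.
  - by rewrite /= lebesgue_measure_itv/= lte_fin e0 sube0 eqe gt_eqF.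
  move=> r /=; rewrite in_itv/= lt_min => /andP[r0 /andP[re rP]].
  rewrite lte_fin /J /half_line r0 mulr_gt0 ?subr_gt0 ?hs ?r0//.
  rewrite lt_max mul1r; apply/orP; right; apply: sin_gt0_pi.
  by rewrite mulr_gt0//= mulrC -ltr_pdivlMr.
split; first by rewrite IJ leeDl// ltW.
by move=> fin; rewrite IJ lteDl.
Qed.
End decreasing_sine.

(** * The symbol of the nonlocal divergence *)

Section vec.
Context (R : realType) (n : nat).
Implicit Types x y a : 'rV[R]_n.

Lemma dotp_delta (j : 'I_n) x : dotp (delta_mx ord0 j) x = x ord0 j.
Proof.
rewrite /dotp (bigD1 j)//= big1 ?addr0 => [|k kj]; rewrite mxE !eqxx/=.
  by rewrite mul1r.
by rewrite (negbTE kj) mul0r.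
Qed.

Lemma dotpC x y : dotp x y = dotp y x.
Proof. by apply: eq_bigr => j _; rewrite mulrC. Qed.

Lemma dotp0r a : dotp a 0 = 0.
Proof. by rewrite /dotp big1// => j _; rewrite mxE mulr0. Qed.

Lemma dotp0l x : dotp 0 x = 0.
Proof. by rewrite dotpC dotp0r. Qed.

Lemma dotpDr a x y : dotp a (x + y) = dotp a x + dotp a y.
Proof. by rewrite -big_split /=; apply: eq_bigr => j _; rewrite mxE; ring. Qed.

Lemma dotpDl x y a : dotp (x + y) a = dotp x a + dotp y a.
Proof. by rewrite dotpC dotpDr !(dotpC a). Qed.

Lemma dotpNl x a : dotp (- x) a = - dotp x a.
Proof. by rewrite /dotp -sumrN; apply: eq_bigr => j _; rewrite mxE; ring. Qed.

Lemma dotpZr (r : R) a x : dotp a (r *: x) = r * dotp a x.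
Proof. by rewrite /dotp mulr_sumr; apply: eq_bigr => j _; rewrite mxE; ring. Qed.

Lemma enorm_ge0 x : 0 <= enorm x. Proof. exact: sqrtr_ge0. Qed.

Lemma enormZ (r : R) x : enorm (r *: x) = `|r| * enorm x.
Proof.
rewrite /enorm dotpZr (_ : dotp _ _ = r * dotp x x); last first.
  by rewrite /dotp mulr_sumr; apply: eq_bigr => j _; rewrite mxE; ring.
by rewrite mulrA -expr2 sqrtrM ?sqr_ge0// sqrtr_sqr.
Qed.

Lemma coord_le_enorm x j : `|x ord0 j| <= enorm x.
Proof.
rewrite -sqrtr_sqr /enorm ler_wsqrtr// /dotp (bigD1 j)//= expr2 lerDl.
by apply: sumr_ge0 => k _; rewrite -expr2 sqr_ge0.
Qed.

Lemma enorm_eq0 x : (enorm x == 0) = (x == 0).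
Proof.
apply/eqP/eqP => [x0|->].
  apply/rowP => j; rewrite mxE; apply/eqP; rewrite -normr_eq0 eq_le normr_ge0 andbT.
  by rewrite -x0 coord_le_enorm.
by rewrite /enorm dotp0r sqrtr0.
Qed.

Lemma enorm_gt0 x : (0 < enorm x) = (x != 0).
Proof. by rewrite lt0r enorm_eq0 enorm_ge0 andbT. Qed.

Lemma dotp_le_enorm a x : `|dotp a x| <= (\sum_j `|a ord0 j|) * enorm x.
Proof.
rewrite /dotp (le_trans (ler_norm_sum _ _ _))// mulr_suml ler_sum// => j _.
by rewrite normrM ler_wpM2l// coord_le_enorm.
Qed.

Lemma measurable_dotp a : measurable_fun setT (dotp a : 'rV[R]_n -> measurableTypeR R).
Proof.
apply: measurable_sum => j; apply: measurable_funM; first exact: measurable_cst.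
exact: measurable_coord.
Qed.

Lemma measurable_enorm : measurable_fun setT (@enorm R n : 'rV[R]_n -> measurableTypeR R).
Proof.
apply: (@measurableT_comp _ _ _ _ _ _ (Num.sqrt : measurableTypeR R -> measurableTypeR R)).
  by apply: continuous_measurable_fun; exact: sqrt_continuous.
apply: measurable_sum => j; apply: measurable_funM; exact: measurable_coord.
Qed.

Lemma measurable_enormV :
  measurable_fun setT ((fun x : 'rV[R]_n => (enorm x)^-1) : 'rV[R]_n -> measurableTypeR R).
Proof.
under eq_fun do rewrite -powR_inv1 ?enorm_ge0//.
exact: (measurableT_comp (@measurable_powR R (-1)) measurable_enorm).
Qed.

Lemma measurable_sin_dotp a :
  measurable_fun setT ((fun x => sin (dotp a x)) : 'rV[R]_n -> measurableTypeR R).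
Proof.
apply: (@measurableT_comp _ _ _ _ _ _ (sin : measurableTypeR R -> measurableTypeR R)).
  by apply: continuous_measurable_fun; exact: continuous_sin.
exact: measurable_dotp.
Qed.

End vec.

Lemma normr_sin_le (R : realType) (t : R) : `|sin t| <= `|t|.
Proof.
wlog t0 : t / 0 <= t => [H|].
  have [/H//|/ltW t0] := lerP 0 t.
  by rewrite -normrN -sinN -[leRHS]normrN H// oppr_ge0.
have [|c _] := @MVT_segment R sin cos 0 t t0 (fun x _ => is_derive_sin x).
  by apply: continuous_subspaceT; exact: continuous_sin.
by rewrite sin0 !subr0 => ->; rewrite normrM ler_piMl// cos_max.
Qed.

Section symbol.
Context (R : realType) (n : nat).
Variable w : R -> R.
Hypothesis mw : measurable_fun setT (half_line w : measurableTypeR R -> measurableTypeR R).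
Hypothesis w0 : forall r, 0 < r -> 0 <= w r.
Hypothesis iw : (\int[leb R n]_x (w (enorm x) * enorm x)%:E < +oo)%E.

(** The integrand of [a . b(a)] when [e = a], and of the [j]-th component of
    [b(a)] when [e] is the [j]-th basis vector. *)
Definition symbol_density (a e s : 'rV[R]_n) : R :=
  w (enorm s) * (dotp e s / enorm s) * sin (dotp a s).

Lemma symbol_densityE a e s :
  symbol_density a e s = half_line w (enorm s) * (dotp e s / enorm s) * sin (dotp a s).
Proof.
rewrite /symbol_density /half_line enorm_gt0; case: ifPn => // /negPn/eqP ->.
by rewrite dotp0r !(mul0r, mulr0).
Qed.

Lemma measurable_half_line_enorm : measurable_fun setT
  ((fun s : 'rV[R]_n => half_line w (enorm s)) : 'rV[R]_n -> measurableTypeR R).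
Proof. exact: (measurableT_comp mw (@measurable_enorm R n)). Qed.

Lemma measurable_symbol_density a e :
  measurable_fun setT (symbol_density a e : 'rV[R]_n -> measurableTypeR R).
Proof.
rewrite (funext (symbol_densityE a e)).
apply: measurable_funM; last exact: measurable_sin_dotp.
apply: measurable_funM; first exact: measurable_half_line_enorm.
apply: measurable_funM; [exact: measurable_dotp|exact: measurable_enormV].
Qed.

(** The sine is bounded by [`|dotp a s|], hence by a multiple of the norm of
    [s], and the first moment of [w] is finite. *)
Lemma integrable_symbol_density a e :
  (leb R n).-integrable setT (EFin \o symbol_density a e).
Proof.
pose A := \sum_j `|a ord0 j|; pose E := \sum_j `|e ord0 j|.
have E0 : 0 <= E by apply: sumr_ge0.
have A0 : 0 <= A by apply: sumr_ge0.
have iwx : (leb R n).-integrable setT (fun x => (half_line w (enorm x) * enorm x)%:E).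
  have mwx : measurable_fun setT ((fun x : 'rV[R]_n => half_line w (enorm x) * enorm x)
      : 'rV[R]_n -> measurableTypeR R).
    by apply: measurable_funM; [exact: measurable_half_line_enorm|exact: measurable_enorm].
  apply/integrableP; split; first exact/measurable_EFinP.
  apply: le_lt_trans iw; rewrite le_eqVlt; apply/orP; left; apply/eqP.
  apply: eq_integral => x _; rewrite gee0_abs ?lee_fin ?mulr_ge0 ?enorm_ge0 ?half_line_ge0//.
  congr EFin; rewrite /half_line enorm_gt0; case: ifPn => // /negPn/eqP ->.
  by rewrite (_ : enorm _ = 0) ?mulr0//; apply/eqP; rewrite enorm_eq0.
have := integrableZl measurableT (E * A) iwx.
apply: (@le_integrable _ _ _ (leb R n) _ measurableT).
  by apply/measurable_EFinP; exact: measurable_symbol_density.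
move=> x _ /=; rewrite lee_fin symbol_densityE !normrM.
have [->|x0] := eqVneq x 0.
  by rewrite dotp0r ?normr0 !(mul0r, mulr0).
have hl0 : 0 <= half_line w (enorm x) by exact: half_line_ge0.
rewrite [leRHS](_ : _ = half_line w (enorm x) * (E * 1) * (A * enorm x)); last first.
  rewrite !(ger0_norm hl0) (ger0_norm E0) (ger0_norm A0) (ger0_norm (enorm_ge0 x)); ring.
rewrite (ger0_norm hl0) ler_pM ?mulr_ge0//.
  rewrite ler_wpM2l// -(@mulfV _ (enorm x)) ?enorm_eq0// mulrA.
  by rewrite normfV (ger0_norm (enorm_ge0 x)) ler_wpM2r ?invr_ge0 ?enorm_ge0// dotp_le_enorm.
by rewrite (le_trans (normr_sin_le _))// dotp_le_enorm.
Qed.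

End symbol.

Section reflection.
Context (R : realType) (n : nat).
Variables (i j : 'I_n) (p q : R).
Hypotheses (ij : i != j) (p0 : p != 0).

Let shear (c : R) (x : 'rV[R]_n) := upd j x (1 * x ord0 j + c * x ord0 i).
Let flip (x : 'rV[R]_n) :=
  upd i x (-1 * x ord0 i + (2 * p * q / (p ^+ 2 + q ^+ 2)) * x ord0 j).

(** The orthogonal reflection along [p e_i - q e_j].  After the shear that
    maps this vector to [p e_i] it only changes the [i]-th coordinate, which
    is why it factors as below. *)
Definition reflection (x : 'rV[R]_n) := shear (- (q / p)) (flip (shear (q / p) x)).

Let c (x : 'rV[R]_n) := 2 * (p * x ord0 i - q * x ord0 j) / (p ^+ 2 + q ^+ 2).

Let pq0 : p ^+ 2 + q ^+ 2 != 0.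
Proof. by rewrite paddr_eq0 ?sqr_ge0// negb_and sqrf_eq0 p0. Qed.

Lemma reflection_i x : reflection x ord0 i = x ord0 i - c x * p.
Proof.
rewrite /reflection /shear /flip /c !updE (negbTE ij) !eqxx.
by rewrite ?(eq_sym j) ?(negbTE ij); field; rewrite ?p0 ?pq0.
Qed.

Lemma reflection_j x : reflection x ord0 j = x ord0 j + c x * q.
Proof.
rewrite /reflection /shear /flip /c !updE (negbTE ij) !eqxx.
by rewrite ?(eq_sym j) ?(negbTE ij); field; rewrite ?p0 ?pq0.
Qed.

Lemma reflection_k x k : k != i -> k != j -> reflection x ord0 k = x ord0 k.
Proof. by move=> ki kj; rewrite /reflection /shear /flip !updE (negbTE ki) (negbTE kj). Qed.

Let dotp_split (a x : 'rV[R]_n) : dotp a x = a ord0 i * x ord0 i +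
  (a ord0 j * x ord0 j + \sum_(k | (k != i) && (k != j)) a ord0 k * x ord0 k).
Proof. by rewrite /dotp (bigD1 i)//= (bigD1 j)//= eq_sym. Qed.

(** The hypotheses say that [a] is orthogonal to [p e_i - q e_j]. *)
Lemma dotp_reflection (a x : 'rV[R]_n) : a ord0 i = q -> a ord0 j = p ->
  dotp a (reflection x) = dotp a x.
Proof.
move=> ai aj; rewrite !dotp_split reflection_i reflection_j ai aj.
under eq_bigr => k /andP[ki kj] do rewrite reflection_k//.
by ring.
Qed.

Lemma enorm_reflection x : enorm (reflection x) = enorm x.
Proof.
rewrite /enorm; congr Num.sqrt.
rewrite !dotp_split reflection_i reflection_j.
under eq_bigr => k /andP[ki kj] do rewrite reflection_k//.
by rewrite /c; field.
Qed.

Lemma normal_reflection x :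
  p * reflection x ord0 i - q * reflection x ord0 j = - (p * x ord0 i - q * x ord0 j).
Proof. by rewrite reflection_i reflection_j /c; field. Qed.

Lemma ge0_integral_reflection (f : 'rV[R]_n -> \bar R) :
  measurable_fun setT f -> (forall x, 0 <= f x)%E ->
  (\int[leb R n]_x f x = \int[leb R n]_x f (reflection x))%E.
Proof.
move=> mf f0.
have ml b k : measurable_fun setT ((fun x : 'rV[R]_n => b * x ord0 k) : 'rV[R]_n -> measurableTypeR R).
  by apply: measurable_funM; [exact: measurable_cst|exact: measurable_coord].
have mu k l b e : measurable_fun setT ((fun x : 'rV[R]_n => upd k x (e * x ord0 k + b * x ord0 l))).
  by apply: measurable_upd_fun; apply: measurable_funD; exact: ml.
have inv (b : R) x t : b * (upd j x t) ord0 i = b * x ord0 i.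
  by rewrite updE (negbTE ij).
have inv2 (b : R) x t : b * (upd i x t) ord0 j = b * x ord0 j.
  by rewrite updE eq_sym (negbTE ij).
rewrite (ge0_integral_leb_shear (oner_neq0 R) (ml (- (q / p)) i) (inv _) mf f0).
rewrite normr1 mul1e.
have mf1 := measurableT_comp mf (mu j i (- (q / p)) 1).
rewrite (ge0_integral_leb_shear (i := i) (a := -1) _
  (ml (2 * p * q / (p ^+ 2 + q ^+ 2)) j) (inv2 _) mf1 (fun x => f0 _)) ?oppr_eq0 ?oner_neq0//.
rewrite normrN1 mul1e.
have mf2 := measurableT_comp mf1 (mu i j (2 * p * q / (p ^+ 2 + q ^+ 2)) (-1)).
rewrite (ge0_integral_leb_shear (oner_neq0 R) (ml (q / p) i) (inv _) mf2 (fun x => f0 _)).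
by rewrite normr1 mul1e.
Qed.

Lemma integral_reflection_odd (f : 'rV[R]_n -> R) :
  (leb R n).-integrable setT (EFin \o f) ->
  (forall x, f (reflection x) = - f x) -> \int[leb R n]_x f x = 0.
Proof.
move=> intf fodd; have mf := measurable_int _ intf.
rewrite /Rintegral integralE.
rewrite (ge0_integral_reflection (measurable_funepos mf) (funepos_ge0 _)).
rewrite (_ : (\int[_]_x _ ^\+ _)%E = (\int[leb R n]_x (fun x => (f x)%:E)^\- x)%E); last first.
  by apply: eq_integral => x _; rewrite funeposE funenegE /= fodd EFinN.
rewrite subee//; apply: integrable_neg_fin_num => //.
Qed.

End reflection.

Section symbol_direction.
Context (R : realType).
Local Notation mu := (@lebesgue_measure R).

Section parallel.
Variables (n : nat) (w : R -> R).
Hypothesis mw : measurable_fun setT (half_line w : measurableTypeR R -> measurableTypeR R).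
Hypothesis w0 : forall r, 0 < r -> 0 <= w r.
Hypothesis iw : (\int[leb R n]_x (w (enorm x) * enorm x)%:E < +oo)%E.
Variable a : 'rV[R]_n.

Local Notation b j := (\int[leb R n]_x symbol_density w a (delta_mx ord0 j) x).

(** The difference of the two sides is the component of [b(a)] along
    [a_j e_i - a_i e_j], up to a factor; reflecting along this vector fixes [a]
    and changes the sign of the integrand. *)
Lemma symbol_parallel (i j : 'I_n) : a ord0 j != 0 -> a ord0 j * b i = a ord0 i * b j.
Proof.
have [->//|ij aj0] := eqVneq i j.
have intf k := integrable_symbol_density mw w0 iw a (delta_mx ord0 k).
apply/eqP; rewrite -subr_eq0 -!RintegralZl// -RintegralB//; last 2 first.
- exact: (integrableZl measurableT (a ord0 j) (intf i)).
- exact: (integrableZl measurableT (a ord0 i) (intf j)).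
apply/eqP; apply: (integral_reflection_odd (p := a ord0 j) (q := a ord0 i) ij).
  apply: (integrableB measurableT (integrableZl measurableT (a ord0 j) (intf i))
    (integrableZl measurableT (a ord0 i) (intf j))).
move=> x; set u := reflection _ _ _ _ x.
have E1 : dotp a u = dotp a x by exact: dotp_reflection.
have E2 : enorm u = enorm x by exact: enorm_reflection.
have E : a ord0 j * u ord0 i - a ord0 i * u ord0 j =
    - (a ord0 j * x ord0 i - a ord0 i * x ord0 j) by exact: normal_reflection.
rewrite /symbol_density E1 E2 !dotp_delta.
transitivity (w (enorm x) * ((a ord0 j * u ord0 i - a ord0 i * u ord0 j) / enorm x) *
  sin (dotp a x)); first by ring.
by rewrite E; ring.
Qed.

Lemma symbol_density_sum x :
  symbol_density w a a x = \sum_j a ord0 j * symbol_density w a (delta_mx ord0 j) x.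
Proof.
rewrite /symbol_density [in LHS]/dotp mulr_suml mulr_sumr mulr_suml.
by apply: eq_bigr => j _; rewrite dotp_delta; ring.
Qed.

Lemma symbol_sum : \sum_j a ord0 j * b j = \int[leb R n]_x symbol_density w a a x.
Proof.
have intf k := integrable_symbol_density mw w0 iw a (delta_mx ord0 k).
under [in RHS]eq_Rintegral do rewrite symbol_density_sum.
rewrite Rintegral_sum//; last by move=> j; exact: (integrableZl measurableT _ (intf j)).
by apply: eq_bigr => j _; rewrite RintegralZl//; exact: intf.
Qed.
End parallel.

Lemma leb_setT_neq0 n : leb R n setT != 0%E.
Proof.
elim: n => [|n IH]; first by rewrite /= diracE in_setT/= onee_neq0.
have := @ge0_integral_leb_cons R n (cst 1%E) (measurable_cst _) (fun=> lee01).
rewrite integral_cst// mul1e => ->.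
under eq_integral do rewrite integral_cst// mul1e.
have muT : mu [set: measurableTypeR R] = +oo%E.
  by have := lebesgue_measure_itv (`]-oo, +oo[ : interval R); rewrite set_itvNyy.
rewrite integral_cst// [X in (_ * X)%E]muT.
by rewrite gt0_muley// lt0e IH measure_ge0.
Qed.

Lemma leb_hyperplane n (e : 'rV[R]_n) (k : R) (j : 'I_n) : e ord0 j != 0 ->
  leb R n [set v | dotp e v + k = 0] = 0%E.
Proof.
move=> ej0; set A := [set v | _].
have mA : measurable A.
  rewrite (_ : A = dotp e @^-1` [set - k]).
    by rewrite -[X in measurable X]setTI; apply: measurable_dotp => //; exact: measurable_set1.
  by apply/seteqP; split => v /=; rewrite /A/=; lra.
have mA1 : measurable_fun setT (fun x => (\1_A x)%:E : \bar R).
  by apply/measurable_EFinP; exact: measurable_indic.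
transitivity (\int[leb R n]_x (\1_A x)%:E)%E; first by rewrite integral_indic// setIT.
rewrite (eq_ge0_integral_slice (i := j) (g := cst 0%E))//; first by rewrite integral_cst// mul0e.
move=> x; rewrite [RHS]integral_cst// mul0e.
transitivity (\int[mu]_t (\1_((upd j x : measurableTypeR R -> _) @^-1` A) t)%:E)%E; first exact: eq_integral.
have mP : measurable ((upd j x : measurableTypeR R -> _) @^-1` A).
  by rewrite -[X in measurable X]setTI; apply: measurable_upd.
rewrite integral_indic// setIT.
(* On the [j]-th slice the hyperplane is the single point [t0]. *)
pose t0 := - (\sum_(i | i != j) e ord0 i * x ord0 i + k) / e ord0 j.
apply/eqP; rewrite -measure_le0 -(lebesgue_measure_set1 t0).
apply: le_measure; rewrite ?inE//.
move=> t; rewrite /A /= /dotp (bigD1 j)//= updE eqxx => H.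
rewrite /t0; apply: (mulfI ej0); rewrite mulrCA mulfV// mulr1.
have := H; rewrite (eq_bigr (fun i => e ord0 i * x ord0 i)); last first.
  by move=> i /negbTE ij; rewrite updE ij.
by move=> /eqP; rewrite -addrA addr_eq0 => /eqP.
Qed.
End symbol_direction.

Section symbol_positive.
Context (R : realType) (n : nat).
Local Notation mu := (@lebesgue_measure R).
Variables (w : R -> R) (delta eta : R).
Hypothesis mw : measurable_fun setT (half_line w : measurableTypeR R -> measurableTypeR R).
Hypothesis w0 : forall r, 0 < r -> 0 <= w r.
Hypothesis iw : (\int[leb R n.+1]_x (w (enorm x) * enorm x)%:E < +oo)%E.
Hypothesis wdelta : forall r, delta < r -> w r = 0.
Hypothesis wdec : forall r s, 0 < r -> r <= s -> s < delta ->
  s ^+ n * w s <= r ^+ n * w r.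
Hypothesis eta0 : 0 < eta <= delta.
Hypothesis wsdec : forall r s, 0 < r -> r < s -> s < eta ->
  s ^+ n * w s < r ^+ n * w r.

Let maxr_pMl (x y : R) : 0 <= x -> Num.max 0 (x * y) = x * Num.max 0 y.
Proof. by move=> x0; rewrite maxr_pMr// mulr0. Qed.

Section ray.
Variables (m al : R).
Hypotheses (m0 : 0 < m) (al0 : al != 0).

(** The density on the line [r (1, v)], for [m] the norm of [(1, v)] and [al]
    its scalar product with the frequency.  It is cut off strictly before
    [delta]: the value of the kernel at the end point is unconstrained and could
    spoil the monotonicity, but it only concerns two points of each line. *)
Definition ray_profile (r : R) : R :=
  if r * m < delta then (`|al| / m) * r ^+ n * half_line w (r * m) else 0.

Let h := ray_profile.

Lemma measurable_ray_profile :
  measurable_fun setT (h : measurableTypeR R -> measurableTypeR R).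
Proof.
have mm : measurable_fun setT ((fun r => r * m) : measurableTypeR R -> measurableTypeR R).
  by apply: measurable_funM; [exact: measurable_id|exact: measurable_cst].
apply: measurable_fun_ifT => //.
  by apply: measurable_fun_ltr => //; exact: measurable_cst.
apply: measurable_funM; last exact: (measurableT_comp mw mm).
apply: measurable_funM; first exact: measurable_cst.
by apply: measurable_funX; exact: measurable_id.
Qed.

Lemma ray_profile_ge0 r : 0 < r -> 0 <= h r.
Proof.
move=> r0; rewrite /h /ray_profile; case: ifPn => // _.
rewrite mulr_ge0 ?half_line_ge0// mulr_ge0// ?divr_ge0// ?exprn_ge0//; exact: ltW.
Qed.

Let hE r : 0 < r -> r * m < delta ->
  h r = `|al| / m ^+ n.+1 * ((r * m) ^+ n * w (r * m)).
Proof.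
move=> r0 rm; rewrite /h /ray_profile rm /half_line mulr_gt0// exprMn exprS.
by field; rewrite expf_neq0 gt_eqF.
Qed.

Let C0 : 0 < `|al| / m ^+ n.+1.
Proof. by rewrite divr_gt0 ?normr_gt0// exprn_gt0. Qed.

Lemma ray_profile_dec r s : 0 < r -> r <= s -> h s <= h r.
Proof.
move=> r0 rs; have s0 := lt_le_trans r0 rs.
have [sm|sm] := ltrP (s * m) delta; last first.
  by rewrite {1}/h /ray_profile ltNge sm/= ray_profile_ge0.
have rsm : r * m <= s * m by rewrite ler_wpM2r// ltW.
rewrite !hE// ?(le_lt_trans rsm)//.
by rewrite ler_wpM2l ?(ltW C0)// wdec// mulr_gt0.
Qed.

Lemma ray_profile_sdec P r : 0 < P -> 0 < r < eta / m -> h (r + P) < h r.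
Proof.
move=> P0 /andP[r0 rm]; have [e0 ed] := andP eta0.
have rme : r * m < eta by rewrite -ltr_pdivlMr.
have rm0 : 0 < r * m by rewrite mulr_gt0.
have rPm : r * m < (r + P) * m by rewrite ltr_pM2r// ltrDl.
(* [wsdec] only holds below [eta], [wdec] only below [delta]: [s] lies between
   the two radii and below [eta], so that one can pass through it. *)
pose s := (r * m + Num.min eta ((r + P) * m)) / 2.
have [s1 s2] : r * m < s /\ s < Num.min eta ((r + P) * m).
  have : r * m < Num.min eta ((r + P) * m) by rewrite lt_min rme.
  by rewrite /s; set M := Num.min _ _; lra.
move: s2; rewrite lt_min => /andP[s2 s3].
have lt1 := wsdec rm0 s1 s2.
have s0 := lt_trans rm0 s1.
have rP0 : 0 < r + P by rewrite addr_gt0.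
rewrite (hE r0) ?(lt_le_trans rme)//.
have [sm|sm] := ltrP ((r + P) * m) delta.
  rewrite hE// ltr_pM2l// (le_lt_trans _ lt1)// wdec//; exact: ltW.
have -> : h (r + P) = 0 by rewrite /h /ray_profile ltNge sm.
rewrite mulr_gt0// (le_lt_trans _ lt1)//.
by rewrite mulr_ge0 ?exprn_ge0 ?w0// ltW.
Qed.

End ray.

Variable a : 'rV[R]_n.+1.
Hypothesis an0 : a != 0.

Let c (v : 'rV[R]_n) : 'rV[R]_n.+1 := rV_cons (1 : measurableTypeR R, v).
Let part (s : R) (x : 'rV[R]_n.+1) := Num.max 0 (s * symbol_density w a a x).
Let line_integral s v := (\int[mu]_r ((`|r| ^+ n)%:E * (part s (r *: c v))%:E))%E.
Let ray_integral (m al s : R) := (\int[mu]_r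
  (half_line (fun r => ray_profile m al r * Num.max 0 (s * sin (`|al| * r))) r)%:E)%E.

Let c_neq0 v : c v != 0.
Proof.
apply/eqP => /rowP /(_ ord0); rewrite rV_cons0 mxE /= => /eqP.
by rewrite oner_eq0.
Qed.

(** Both [t * sin t] and [`|r|] are even, so the two half-lines contribute
    the same amount. *)
Let line_integralE s v : dotp a (c v) != 0 ->
  line_integral s v = (ray_integral (enorm (c v)) (dotp a (c v)) s + ray_integral (enorm (c v)) (dotp a (c v)) s)%E.
Proof.
move=> al0; set al := dotp _ _ in al0 *; set m := enorm _.
have m0 : 0 < m by rewrite enorm_gt0.
pose H r := ray_profile m al r * Num.max 0 (s * sin (`|al| * r)).
have mH : measurable_fun setT (H : measurableTypeR R -> measurableTypeR R).
  apply: measurable_funM; first exact: measurable_ray_profile.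
  apply: measurable_maxr; first exact: measurable_cst.
  apply: measurable_funM; first exact: measurable_cst.
  by under eq_fun do rewrite -[(_ * _)%R]addr0; exact: measurable_sin_affine.
rewrite /ray_integral -integral_norm_half_line//; last 2 first.
- by move=> r r0; rewrite mulr_ge0 ?ray_profile_ge0// le_max lexx.
- by rewrite mulr0 sin0 mulr0 maxxx mulr0.
have mrc : measurable_fun setT (fun r : measurableTypeR R => (r : R) *: c v).
  by apply: measurable_scale => //; exact: measurable_cst.
apply: ge0_ae_eq_integral => //.
- apply: emeasurable_funM.
    by apply/measurable_EFinP; apply: measurable_funX; exact: normr_measurable.
  apply/measurable_EFinP; apply: measurable_maxr; first exact: measurable_cst.
  apply: measurable_funM; first exact: measurable_cst.
  exact: (measurableT_comp (measurable_symbol_density mw a a) mrc).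
- apply/measurable_EFinP.
  exact: (measurableT_comp mH (@normr_measurable R setT)).
- by move=> r _; rewrite -EFinM lee_fin mulr_ge0 ?exprn_ge0// le_max lexx.
- move=> r _; rewrite lee_fin; have [->|r0] := eqVneq (r : R) 0.
    by rewrite normr0 /H mulr0 sin0 mulr0 maxxx mulr0.
  by rewrite mulr_ge0 ?ray_profile_ge0 ?normr_gt0// le_max lexx.
exists [set delta / m; - (delta / m)]; split.
- by apply: measurableU; exact: measurable_set1.
- rewrite measureU0; [exact: lebesgue_measure_set1|exact: measurable_set1|exact: measurable_set1|exact: lebesgue_measure_set1].
move=> r /=; apply: contra_notP => rN _.
have rm : `|r| * m != delta.
  apply/eqP => rm; apply: rN; rewrite -rm mulfK ?gt_eqF//.
  by have [r0|r0] := lerP 0 (r : R); [left; rewrite ger0_norm|right; rewrite ltr0_norm// opprK].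
rewrite -EFinM; congr EFin.
have [->|r0] := eqVneq (r : R) 0.
  rewrite /H normr0 mulr0 sin0 mulr0 maxxx mulr0 /part scale0r /symbol_density.
  by rewrite dotp0r sin0 !mulr0 maxxx mulr0.
have r0' : 0 < `|r| by rewrite normr_gt0.
rewrite /part symbol_densityE enormZ dotpZr -/al -/m /H /ray_profile.
have sinE : r * al / (`|r| * m) * sin (r * al) = `|al| / m * sin (`|al| * `|r|).
  have ts (t : R) : t * sin t = `|t| * sin `|t|.
    have [t0|t0] := lerP 0 t; first by rewrite ger0_norm.
    by rewrite ltr0_norm// sinN mulrNN.
  have := ts (r * al); rewrite normrM => E.
  transitivity ((r * al * sin (r * al)) / (`|r| * m)); first by field; rewrite !gt_eqF.
  rewrite E [`|al| * `|r|]mulrC; field; by rewrite !gt_eqF.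
have [rm'|] := ltrP (`|r| * m) delta; last first.
  rewrite le_eqVlt eq_sym (negbTE rm)/= => /wdelta w00.
  rewrite /half_line w00 (_ : (if _ then 0 else 0) = 0); last by case: ifP.
  by rewrite !mul0r mulr0 maxxx mulr0.
rewrite -[in LHS]mulrA sinE.
rewrite (_ : s * _ = (half_line w (`|r| * m) * (`|al| / m)) * (s * sin (`|al| * `|r|))); last by ring.
rewrite maxr_pMl; first by ring.
by rewrite mulr_ge0 ?half_line_ge0// divr_ge0// ltW.
Qed.

Let measurable_part s : measurable_fun setT (fun x => (part s x)%:E).
Proof.
apply/measurable_EFinP; apply: measurable_maxr; first exact: measurable_cst.
apply: measurable_funM; first exact: measurable_cst.
exact: measurable_symbol_density.
Qed.

Let part_ge0 s x : (0 <= (part s x)%:E)%E. Proof. by rewrite lee_fin le_max lexx. Qed.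

(** The directions [v] for which [a . (1, v) = 0], on whose lines the integrand
    vanishes, form a hyperplane or the empty set. *)
Let slope_neq0 : leb R n [set v | dotp a (c v) != 0] != 0%E /\
  measurable [set v | dotp a (c v) != 0].
Proof.
have mB : measurable [set v | dotp a (c v) = 0].
  rewrite (_ : mkset _ = (fun v => dotp a (c v)) @^-1` [set 0]) //.
  rewrite -[X in measurable X]setTI; apply: (measurableT_comp (measurable_dotp a)) => //.
  by apply: measurable_cons => //; exact: measurable_cst.
have BC : [set v | dotp a (c v) != 0] = ~` [set v | dotp a (c v) = 0].
  by apply/seteqP; split => v /=; move/eqP.
split; last by rewrite BC; exact: measurableC.
suff B0 : leb R n [set v | dotp a (c v) = 0] = 0%E.
  rewrite BC; apply: contra_neq (leb_setT_neq0 R n) => C0.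
  rewrite -(setUv [set v | dotp a (c v) = 0]); apply/eqP.
  by rewrite measureU0//; [exact/eqP|exact: measurableC].
have dE v : dotp a (c v) = dotp (\row_j a ord0 (lift ord0 j)) v + a ord0 ord0.
  rewrite /dotp big_ord_recl rV_cons0 /= mulr1 addrC; congr (_ + _).
  by apply: eq_bigr => j _; rewrite rV_consS mxE.
have [/existsP[j aj]|/existsPn aj] := boolP [exists j : 'I_n, a ord0 (lift ord0 j) != 0].
  under eq_set do rewrite dE.
  by apply: (@leb_hyperplane R n _ _ j); rewrite mxE.
rewrite (_ : mkset _ = set0) ?measure0//; apply/seteqP; split => // v /=.
rewrite dE /dotp big1 ?add0r => [a0|j _]; last first.
  by have := aj j; rewrite negbK mxE => /eqP ->; rewrite mul0r.
move/eqP: an0; apply; apply/rowP => j; rewrite mxE.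
by have [k ->|->//] := unliftP ord0 j; have := aj k; rewrite negbK => /eqP.
Qed.

Let ray_integral_lt m al : 0 < m -> al != 0 -> (ray_integral m al (-1) <= ray_integral m al 1)%E /\
  (ray_integral m al (-1) \is a fin_num -> (ray_integral m al (-1) < ray_integral m al 1)%E).
Proof.
move=> m0 al0; have al0' : 0 < `|al| by rewrite normr_gt0.
apply: (decreasing_sine (eta := eta / m)) => //.
- exact: measurable_ray_profile.
- by move=> r r0; exact: ray_profile_ge0.
- by move=> r s; exact: ray_profile_dec.
- by rewrite divr_gt0//; case/andP : eta0.
- by move=> r; apply: ray_profile_sdec => //; rewrite divr_gt0// pi_gt0.
Qed.

(** The positive and the negative part of the density are integrated
    separately by Tonelli, and compared line by line. *)
Lemma symbol_positive : 0 < \int[leb R n.+1]_x symbol_density w a a x.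
Proof.
have intf := integrable_symbol_density mw w0 iw a a.
have [Apos mA] := slope_neq0.
have E s : (\int[leb R n.+1]_x (part s x)%:E = \int[leb R n]_v line_integral s v)%E.
  exact: ge0_integral_leb_cone.
have Ep : (\int[leb R n.+1]_x (part 1 x)%:E =
    \int[leb R n.+1]_x (EFin \o symbol_density w a a)^\+ x)%E.
  by apply: eq_integral => x _; rewrite funeposE/= /part mul1r maxC EFin_max.
have En : (\int[leb R n.+1]_x (part (-1) x)%:E =
    \int[leb R n.+1]_x (EFin \o symbol_density w a a)^\- x)%E.
  by apply: eq_integral => x _; rewrite funenegE/= /part mulN1r maxC EFin_max EFinN.
have pfin := integrable_pos_fin_num measurableT intf.
have nfin := integrable_neg_fin_num measurableT intf.
have lt : (\int[leb R n]_v line_integral (-1) v < \int[leb R n]_v line_integral 1 v)%E.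
  apply: (ge0_lt_integral (A := [set v | dotp a (c v) != 0])) => //.
  - exact: (measurable_fun_leb_cone (measurable_part (-1)) (part_ge0 (-1))).
  - exact: (measurable_fun_leb_cone (measurable_part 1) (part_ge0 1)).
  - by move=> v; apply: integral_ge0 => r _; rewrite mule_ge0// lee_fin exprn_ge0.
  - move=> v; have [al0|al0] := eqVneq (dotp a (c v)) 0.
      rewrite le_eqVlt; apply/orP; left; apply/eqP; apply: eq_integral => r _.
      by rewrite /part /symbol_density dotpZr al0 !(mulr0, mul0r).
    rewrite !line_integralE//; have m0 : 0 < enorm (c v) by rewrite enorm_gt0.
    have [le _] := ray_integral_lt m0 al0.
    exact: leeD.
  - by rewrite -E Ep ltey_eq pfin.
  - move=> v /= al0; rewrite !line_integralE//; have m0 : 0 < enorm (c v) by rewrite enorm_gt0.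
    rewrite fin_numD andbb => fin; have [le lt] := ray_integral_lt m0 al0.
    by apply: lte_leD => //; exact: lt.
rewrite /Rintegral integralE -Ep -En !E fine_gt0// sube_gt0 lt/=.
by rewrite -!E Ep En ltey_eq fin_numB pfin nfin.
Qed.

End symbol_positive.

Section kernel_symbol.
Context (R : realType) (n : nat).
Variables (omega omega_hat : R -> R) (delta : R).
Hypothesis homega_hat : is_kernel omega_hat.
Hypothesis hK : kernel_assumptions n.+1 omega omega_hat.
Hypothesis delta0 : 0 < delta.

Local Notation w := (scaled_omega_hat n.+1 omega_hat delta).

Let measurable_w :
  measurable_fun setT (half_line w : measurableTypeR R -> measurableTypeR R).
Proof.
have [mo _ _] := homega_hat.
have moh : measurable_fun setT (half_line omega_hat : measurableTypeR R -> measurableTypeR R).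
  apply: measurable_fun_if => //.
  - by apply: measurable_fun_ltr => //; exact: measurable_cst.
  - rewrite setTI (_ : _ @^-1` _ = [set` `]0%R, +oo[])//.
    by apply/seteqP; split => r; rewrite /= in_itv/= andbT.
rewrite (_ : half_line w = fun r => delta ^- n.+2 * half_line omega_hat (delta^-1 * r + 0)).
  apply: measurable_funM; first exact: measurable_cst.
  exact: (measurableT_comp moh (@measurable_affine R delta^-1 0)).
apply/funext => r; rewrite /half_line /scaled_omega_hat addr0 pmulr_rgt0 ?invr_gt0//.
by case: ifP => _; rewrite ?mulr0// [_ / _]mulrC.
Qed.

Let w_ge0 r : 0 < r -> 0 <= w r.
Proof.
have [_ h0 _] := homega_hat; move=> r0.
by rewrite mulr_ge0 ?h0 ?divr_gt0// invr_ge0 exprn_ge0// ltW.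
Qed.

Let w_support r : delta < r -> w r = 0.
Proof.
have [_ _ h1] := homega_hat; move=> r0.
by rewrite /scaled_omega_hat h1 ?mulr0// ltr_pdivlMr// mul1r.
Qed.

Let wE r : 0 < r -> r ^+ n * w r = delta ^- 2 * ((r / delta) ^+ n * omega_hat (r / delta)).
Proof.
move=> r0; rewrite /scaled_omega_hat expr_div_n !exprS.
by field; rewrite expf_neq0 gt_eqF.
Qed.

Let w_dec r s : 0 < r -> r <= s -> s < delta -> s ^+ n * w s <= r ^+ n * w r.
Proof.
have [_ _ dec _] := hK; move=> r0 rs sd; have s0 := lt_le_trans r0 rs.
rewrite !wE// ler_wpM2l ?invr_ge0 ?exprn_ge0 ?(ltW delta0)//.
apply: dec; first by rewrite divr_gt0.
  by rewrite ler_pM2r ?invr_gt0.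
by rewrite ltr_pdivrMr// mul1r.
Qed.

(** Below the scaled threshold, [r ^+ n * w r] is a constant times
    [(r / delta) `^ (- 1 - beta)], and [beta > -1]. *)
Let w_sdec : exists2 eta, 0 < eta <= delta &
  forall r s, 0 < r -> r < s -> s < eta -> s ^+ n * w s < r ^+ n * w r.
Proof.
have [_ _ _ [eps [c [beta [/andP[eps0 eps1] c0 /andP[b1 b2] hE]]]]] := hK.
exists (eps * delta); first by rewrite mulr_gt0//= ler_piMl// ltW.
move=> r s r0 rs sd; have s0 := lt_trans r0 rs.
rewrite !wE// ltr_pM2l ?invr_gt0 ?exprn_gt0//.
have r1 : 0 < r / delta by rewrite divr_gt0.
have rs1 : r / delta < s / delta by rewrite ltr_pM2r ?invr_gt0.
have s1 : s / delta < eps by rewrite ltr_pdivrMr.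
have key x : 0 < x -> x < eps -> x ^+ n * omega_hat x = c * (x `^ (1 + beta))^-1.
  move=> x0 xe; rewrite hE ?x0// mulrCA -powR_mulrn ?ltW// -powRD; last first.
    by rewrite (gt_eqF x0) implybT.
  by rewrite -powRN; congr (_ * _ `^ _); rewrite -natr1; ring.
have s1' : 0 < s / delta by rewrite divr_gt0.
have b1' : 0 < 1 + beta by lra.
rewrite !key ?(lt_trans rs1)// ltr_pM2l// ltf_pV2 ?posrE ?powR_gt0//.
by apply: gt0_ltr_powR => //; rewrite nnegrE ltW.
Qed.

Let w_moment : (\int[leb R n.+1]_x (w (enorm x) * enorm x)%:E < +oo)%E.
Proof. by have [_ -> // _ _] := hK; rewrite ltry. Qed.

Lemma b_symbolE (xi : 'rV[int]_n.+1) j : b_symbol omega_hat delta xi j =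
  \int[leb R n.+1]_s symbol_density w (freq xi) (delta_mx ord0 j) s.
Proof.
rewrite /b_symbol Rintegral_mkcond; apply: eq_Rintegral => s _.
rewrite patchE /symbol_density dotp_delta; case: ifPn => //.
rewrite notin_setE /= => /negP; rewrite -ltNge => sd.
by rewrite w_support// !mul0r.
Qed.

Lemma b_symbol_direction (xi : 'rV[int]_n.+1) : xi != 0 ->
  exists2 l : R, l != 0 & forall j, b_symbol omega_hat delta xi j = l * freq xi ord0 j.
Proof.
move=> xi0; have [j xij] : exists j, xi ord0 j != 0.
  apply/existsP; apply: contraNT xi0 => /existsPn xi0; apply/eqP/rowP => j.
  by rewrite mxE; apply/eqP/negPn/xi0.
have fj0 : freq xi ord0 j != 0 :> R by rewrite mxE intr_eq0.
have f0 : freq xi != 0 :> 'rV[R]_n.+1.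
  by apply: contraNneq fj0 => ->; rewrite mxE.
have [eta eta0 sdec] := w_sdec.
have bE i : b_symbol omega_hat delta xi i =
    b_symbol omega_hat delta xi j / freq xi ord0 j * freq xi ord0 i.
  apply: (mulfI fj0); rewrite !b_symbolE.
  by rewrite symbol_parallel//; field.
exists (b_symbol omega_hat delta xi j / freq xi ord0 j); last exact: bE.
have := symbol_positive measurable_w w_ge0 w_moment w_support w_dec eta0 sdec f0.
rewrite -symbol_sum//; under eq_bigr do rewrite -b_symbolE bE.
move=> H; apply: contraTneq H => ->; rewrite big1 ?ltxx// => i _.
by rewrite mul0r mulr0.
Qed.

Lemma b_symbol0 j : b_symbol omega_hat delta (0 : 'rV[int]_n.+1) j = 0.
Proof.
rewrite b_symbolE (_ : (fun s => _) = cst 0); first by rewrite Rintegral_cst// mul0r.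
apply/funext => s; rewrite /symbol_density (_ : dotp (freq 0) s = 0) ?sin0 ?mulr0//.
by rewrite /dotp big1// => i _; rewrite !mxE mul0r.
Qed.

End kernel_symbol.

(** * The periodic cell *)

Section cell.
Context (R : realType) (n : nat).
Local Notation mu := (@lebesgue_measure R).

(** The sigma-algebra is generated by the coordinates, so that open sets are
    not measurable by definition.  Here [f] is the limit of its compositions
    with the rounding of the coordinates down to multiples of [1 / k.+1], which
    take countably many values. *)
Lemma continuous_rV_measurable (f : 'rV[R]_n -> R) : continuous f ->
  measurable_fun setT (f : 'rV[R]_n -> measurableTypeR R).
Proof.
move=> cf.
pose q (k : nat) (x : 'rV[R]_n) : 'rV[int]_n := map_mx (fun t => Num.floor (t * k.+1%:R)) x.
pose p (k : nat) (z : 'rV[int]_n) : 'rV[R]_n := map_mx (fun z => z%:~R / k.+1%:R) z.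
apply: (measurable_fun_cvg (h := fun k x => f (p k (q k x)))).
  move=> k _ B mB; rewrite setTI.
  rewrite (_ : _ @^-1` B = \bigcup_(z in [set z | B (f (p k z))])
      \bigcap_(j in [set: 'I_n]) (fun x : 'rV[R]_n => x ord0 j : measurableTypeR R) @^-1`
        [set` `[(z ord0 j)%:~R / k.+1%:R, ((z ord0 j) + 1)%:~R / k.+1%:R[]).
    rewrite bigcup_mkcond; apply: countable_bigcupT_measurable; first exact: countableP.
    move=> z; case: ifP => _; last exact: measurable0.
    apply: fin_bigcap_measurable; first exact: finite_finset.
    move=> j _; rewrite -[X in measurable X]setTI.
    by apply: measurable_coord => //; exact: measurable_itv.
  apply/seteqP; split => x /=.
    move=> Bx; exists (q k x) => //= j _ /=; rewrite in_itv/= mxE.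
    rewrite ler_pdivrMr// ltr_pdivlMr//.
    exact: floor_itv.
  move=> [z Bz /= xz]; suff -> : q k x = z by [].
  apply/rowP => j; rewrite mxE; apply: floor_def.
  by have := xz j I; rewrite /= in_itv/= ler_pdivrMr// ltr_pdivlMr.
move=> x _.
suff px : (fun k => p k (q k x)) @ \oo --> (x : 'rV[R]_n) by exact: (cvg_comp _ _ px (cf x)).
apply/cvg_ballP => e e0; near=> k; split => // i j.
rewrite (ord1 i) /ball/= !mxE.
have k0 : 0 < k.+1%:R :> R by [].
have := floor_itv (x ord0 j * k.+1%:R).
rewrite intrD; set F := (Num.floor _)%:~R => /andP[h1 h2].
have ke : k.+1%:R^-1 < e by near: k; exact: near_infty_natSinv_lt (PosNum e0).
apply: le_lt_trans ke.
have -> : x ord0 j - F / k.+1%:R = (x ord0 j * k.+1%:R - F) / k.+1%:R.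
  by field; rewrite gt_eqF.
rewrite normrM normfV (gtr0_norm k0) ler_pdivrMr// mulVf ?gt_eqF// ger0_norm; lra.
Unshelve. all: by end_near.
Qed.

Lemma measurable_cell : measurable (cell R n).
Proof.
rewrite (_ : cell R n = \bigcap_(j in [set: 'I_n])
    (fun x : 'rV[R]_n => x ord0 j : measurableTypeR R) @^-1` [set` `]- pi, pi[ ]).
  apply: fin_bigcap_measurable; first exact: finite_finset.
  move=> j _; rewrite -[X in measurable X]setTI.
  by apply: measurable_coord => //; exact: measurable_itv.
apply/seteqP; split => x /=.
  by move=> cx j _ /=; rewrite in_itv/= cx.
by move=> cx j; have := cx j I; rewrite /= in_itv.
Qed.

End cell.
Arguments measurable_cell : clear implicits.

Lemma leb_cell (R : realType) n : leb R n (cell R n) = ((2 * pi) ^+ n)%:E.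
Proof.
elim: n => [|n IH].
  by rewrite /= diracE expr0 mem_set// => -[].
have m1 k : measurable_fun setT (fun x : 'rV[R]_k => (\1_(cell R k) x)%:E : \bar R).
  by apply/measurable_EFinP; apply: measurable_indic; exact: measurable_cell.
have ge1 k x : (0 <= (\1_(cell R k) x)%:E :> \bar R)%E by rewrite lee_fin.
transitivity (\int[leb R n.+1]_x (\1_(cell R n.+1) x)%:E)%E.
  by rewrite integral_indic ?setIT//; exact: measurable_cell.
rewrite (ge0_integral_leb_cons (m1 _) (ge1 _)).
transitivity (\int[@lebesgue_measure R]_s ((((2 * pi) ^+ n)%:E * (\1_(`]- pi, pi[ : set R) s)%:E)))%E.
  apply: eq_integral => s _; transitivity
    (\int[leb R n]_v ((\1_(`]- pi, pi[ : set R) s)%:E * (\1_(cell R n) v)%:E))%E.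
    apply: eq_integral => v _; rewrite -EFinM; congr EFin.
    rewrite !indicE -natrM mulnb; congr ((nat_of_bool _)%:R); apply/idP/idP.
      rewrite inE => cx; apply/andP; split; rewrite inE.
        by have := cx ord0; rewrite rV_cons0/= in_itv.
      by move=> j; have := cx (lift ord0 j); rewrite rV_consS.
    move=> /andP[]; rewrite !inE/= in_itv/= => cs cv j.
    by have [k ->|->] := unliftP ord0 j; rewrite ?rV_consS ?rV_cons0.
  rewrite ge0_integralZl ?lee_fin//; last exact: m1.
  rewrite integral_indic ?setIT//; last exact: measurable_cell.
  by rewrite [X in (_ * X)%E]IH muleC.
rewrite ge0_integralZl//; last 2 first.
- by apply/measurable_EFinP; apply: measurable_indic; exact: measurable_itv.
- by rewrite lee_fin exprn_ge0// mulr_ge0// pi_ge0.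
rewrite integral_indic ?setIT//.
rewrite [X in (_ * X)%E]lebesgue_measure_itv/= lte_fin gtrN ?pi_gt0//.
by rewrite -EFinB -EFinM exprSr; congr EFin; ring.
Qed.

Section cell_integrable.
Context (R : realType) (n : nat).

Lemma cell_bounded (f : 'rV[R]_n -> R) : continuous f ->
  exists2 M : R, 0 < M & forall x : 'rV[R]_n, (forall j, - pi <= x ord0 j <= pi) -> `|f x| <= M.
Proof.
move=> cf.
pose A := [set x : 'rV[R]_n | forall j, `[- pi, pi]%classic (x ord0 j)].
have cA : compact A.
  by apply: (rV_compact (A := fun=> `[- pi, pi]%classic)) => j; exact: segment_compact.
have A0 : A !=set0.
  by exists 0 => j; rewrite /= in_itv/= mxE lerNl oppr0 pi_ge0.
have cn : {within A, continuous (fun x => `|f x|)}.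
  by apply: continuous_subspaceT => x; apply: continuous_comp; [exact: cf|exact: norm_continuous].
have [c _ cmax] := EVT_max_rV A0 cA cn.
exists (`|f c| + 1) => [|x xA]; first by rewrite ltr_wpDl.
by rewrite (le_trans (cmax x _)) ?lerDl// inE => j; rewrite /= in_itv/= xA.
Qed.

Lemma cell_closed (x : 'rV[R]_n) : cell R n x -> forall j, - pi <= x ord0 j <= pi.
Proof. by move=> cx j; have /andP[/ltW -> /ltW ->] := cx j. Qed.

Lemma cell_integrable_cst (M : R) : (leb R n).-integrable (cell R n) (EFin \o cst M).
Proof.
apply: measurable_bounded_integrable.
- exact: measurable_cell.
- by rewrite [X in (X < _)%E]leb_cell ltry.
- exact: measurable_cst.
- by exists `|M|; split; [exact: num_real|move=> y /ltW My x _ /=].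
Qed.

Lemma cell_integrable (f : 'rV[R]_n -> R) : continuous f ->
  (leb R n).-integrable (cell R n) (EFin \o f).
Proof.
move=> cf; have [M M0 fM] := cell_bounded cf.
have := cell_integrable_cst M.
apply: le_integrable; first exact: measurable_cell.
  apply/measurable_EFinP; apply: measurable_funTS; exact: continuous_rV_measurable.
by move=> x /cell_closed /fM fx; rewrite lee_fin/= (gtr0_norm M0).
Qed.

Lemma integrable_mul_continuous (g f : 'rV[R]_n -> R) :
  (leb R n).-integrable (cell R n) (EFin \o g) -> continuous f ->
  (leb R n).-integrable (cell R n) (EFin \o (fun x => g x * f x)).
Proof.
move=> ig cf; have [M M0 fM] := cell_bounded cf.
have mg : measurable_fun (cell R n) (g : 'rV[R]_n -> measurableTypeR R).
  by apply/measurable_EFinP; exact: measurable_int ig.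
have := integrableZl (measurable_cell R n) M ig.
apply: le_integrable; first exact: measurable_cell.
  apply/measurable_EFinP; apply: measurable_funM => //.
  by apply: measurable_funTS; exact: continuous_rV_measurable.
move=> x /cell_closed /fM fx /=; rewrite lee_fin !normrM (gtr0_norm M0) mulrC.
by rewrite ler_wpM2r.
Qed.

End cell_integrable.

Section torus_derivative.
Context (R : realType) (n : nat).
Local Notation mu := (@lebesgue_measure R).
Local Notation e_ j := (delta_mx ord0 j : 'rV[R]_n).

Lemma updDr (j : 'I_n) (x : 'rV[R]_n) s t : upd j x (s + t) = s *: e_ j + upd j x t.
Proof.
apply/rowP => i; rewrite !mxE eqxx /=; case: eqP => _; first by rewrite mulr1.
by rewrite mulr0 add0r.
Qed.

Lemma continuous_upd (j : 'I_n) (x : 'rV[R]_n) : continuous (upd j x : R -> 'rV[R]_n).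
Proof.
have -> : upd j x = fun t => t *: e_ j + upd j x 0.
  by apply/funext => t; rewrite -updDr addr0.
move=> t; apply: cvgD; last exact: cvg_cst.
by apply: cvgZr_tmp => //; exact: cvg_id.
Qed.

Lemma is_derive_slice (h : 'rV[R]_n -> R) (j : 'I_n) x (t : R) :
  derivable h (upd j x t) (e_ j) ->
  is_derive t 1 (fun s => h (upd j x s)) (partial j h (upd j x t)).
Proof.
move=> dh; have E : (fun s : R => s^-1 *: (h (upd j x (s *: 1 + t)) - h (upd j x t))) =
    (fun s : R => s^-1 *: (h (s *: e_ j + upd j x t) - h (upd j x t))).
  by apply/funext => s; rewrite updDr [s *: 1]mulr1.
apply: DeriveDef; first by rewrite /derivable E.
by rewrite /partial /derive E.
Qed.

(** The fundamental theorem of calculus on each slice, where the boundary terms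
    cancel by periodicity.  It is applied to the positive and negative parts,
    since slices are compared for nonnegative functions. *)
Lemma integral_partial_cell (h : 'rV[R]_n -> R) (j : 'I_n) :
  continuous h -> (forall x, derivable h x (e_ j)) -> continuous (partial j h) ->
  (forall x, h (upd j x pi) = h (upd j x (- pi))) ->
  \int[leb R n]_(x in cell R n) partial j h x = 0.
Proof.
move=> ch dh cg hper; set g := partial j h.
have pi2 : - pi < pi :> R by rewrite gtrN ?pi_gt0.
pose gx x t := g (upd j x t).
have cgx x : continuous (gx x : R -> R).
  by move=> t; apply: continuous_comp; [exact: continuous_upd|exact: cg].
have igx x : mu.-integrable `]- pi, pi[ (EFin \o gx x).
  apply: (@integrableS _ _ _ mu `[- pi, pi]) => //.
    by apply: subset_itvW; rewrite lexx.
  apply: continuous_compact_integrable; first exact: segment_compact.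
  exact: continuous_subspaceT.
have slice0 x : (\int[mu]_(t in `](- pi)%R, pi%R[) (gx x t)%:E = 0)%E.
  have mgx (A : set R) : measurable_fun A (EFin \o gx x).
    by apply/measurable_EFinP; apply: measurable_funTS; exact: continuous_measurable_fun.
  rewrite integral_itv_obnd_cbnd// integral_itv_bndo_bndc//.
  rewrite (continuous_FTC2 (F := fun t => h (upd j x t)) pi2).
  - by rewrite hper -EFinB subrr.
  - exact: continuous_subspaceT.
  - have cH : continuous (fun t : R => h (upd j x t)).
      by move=> t; apply: continuous_comp; [exact: continuous_upd|exact: ch].
    split=> [t _| |].
    + by have [] := is_derive_slice (dh (upd j x t)).
    + by apply: cvg_at_right_filter; exact: cH.
    + by apply: cvg_at_left_filter; exact: cH.
  - move=> t _; rewrite derive1E.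
    by have [_ ->] := is_derive_slice (dh (upd j x t)).
have ig := cell_integrable cg.
have mg : measurable_fun setT ((EFin \o g) \_ (cell R n)).
  by apply/(measurable_restrictT _ (measurable_cell R n)); exact: measurable_int ig.
rewrite /Rintegral integral_mkcond integralE.
suff -> : (\int[leb R n]_x ((EFin \o g) \_ (cell R n))^\+ x =
           \int[leb R n]_x ((EFin \o g) \_ (cell R n))^\- x)%E.
  rewrite subee//; apply: integrable_neg_fin_num => //.
  by apply/(integrable_mkcond _ (measurable_cell R n)).
apply: (eq_ge0_integral_slice (i := j)).
- exact: measurable_funepos.
- exact: measurable_funeneg.
- by move=> x; exact: funepos_ge0.
- by move=> x; exact: funeneg_ge0.
move=> x; have [cx|ncx] := pselect (forall i, i != j -> - pi < x ord0 i < pi); last first.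
  have out t : ((EFin \o g) \_ (cell R n)) (upd j x t) = 0%E.
    rewrite patchE ifN//; apply/negP; rewrite inE => cu; apply: ncx => i ij.
    by have := cu i; rewrite updE (negbTE ij).
  by apply: eq_integral => t _; rewrite funeposE funenegE out oppe0.
have E t : ((EFin \o g) \_ (cell R n)) (upd j x t) = ((EFin \o gx x) \_ ([set` `](- pi)%R, pi%R[])) t.
  rewrite !patchE; congr (if _ then _ else _); apply/idP/idP; rewrite !inE /=.
    by move=> /(_ j); rewrite updE eqxx in_itv.
  by rewrite in_itv/= => tp i; rewrite updE; case: eqP => [//|/eqP /cx].
transitivity (\int[mu]_t ((EFin \o gx x) \_ ([set` `](- pi)%R, pi%R[]))^\+ t)%E.
  by apply: eq_integral => t _; rewrite !funeposE E.
transitivity (\int[mu]_t ((EFin \o gx x) \_ ([set` `](- pi)%R, pi%R[]))^\- t)%E; last first.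
  by apply: eq_integral => t _; rewrite !funenegE E.
apply: integral0_pos_neg; first by rewrite -integrable_mkcond//; exact: igx.
by rewrite -integral_mkcond; exact: slice0.
Qed.

End torus_derivative.

(** * Waves *)

Lemma continuous_Rsum (R : realType) (T : topologicalType) (I : Type) (s : seq I)
    (F : I -> T -> R) : (forall i, continuous (F i)) ->
  continuous (fun x => \sum_(i <- s) F i x).
Proof. by move=> cF; apply: continuous_big => //; exact: add_continuous. Qed.

Lemma continuous_Rmul (R : realType) (T : topologicalType) (f g : T -> R) :
  continuous f -> continuous g -> continuous (fun x => f x * g x).
Proof. by move=> cf cg x; apply: continuousM; [exact: cf|exact: cg]. Qed.

Lemma continuous_Rscale (R : realType) (T : topologicalType) (c : R) (f : T -> R) :
  continuous f -> continuous (fun x => c * f x).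
Proof. by apply: continuous_Rmul; exact: cst_continuous. Qed.

Lemma continuous_Radd (R : realType) (T : topologicalType) (f g : T -> R) :
  continuous f -> continuous g -> continuous (fun x => f x + g x).
Proof. by move=> cf cg x; apply: continuousD; [exact: cf|exact: cg]. Qed.

Lemma continuous_Rsub (R : realType) (T : topologicalType) (f g : T -> R) :
  continuous f -> continuous g -> continuous (fun x => f x - g x).
Proof. by move=> cf cg x; apply: continuousB; [exact: cf|exact: cg]. Qed.

Lemma continuous_Rnorm (R : realType) (T : topologicalType) (f : T -> R) :
  continuous f -> continuous (fun x => `|f x|).
Proof.
by move=> cf x; apply: (@continuous_comp _ _ _ f (fun r : R => `|r|));
  [exact: cf|exact: norm_continuous].
Qed.

Section waves.
Context (R : realType) (n : nat).
Implicit Types (k : 'rV[int]_n) (x y : 'rV[R]_n) (t s : R).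
Local Notation e_ j := (delta_mx ord0 j : 'rV[R]_n).

(** The phase [t] covers sine and cosine at once, and makes the family stable
    under differentiation, which adds [pi / 2] to it. *)
Definition wave k t x : R := sin (dotp (freq k) x + t).

Lemma freqD k l : freq (k + l) = freq k + freq l :> 'rV[R]_n.
Proof. by apply/rowP => j; rewrite !mxE intrD. Qed.

Lemma freqN k : freq (- k) = - freq k :> 'rV[R]_n.
Proof. by apply/rowP => j; rewrite !mxE intrN. Qed.

Lemma freq0 : freq 0 = 0 :> 'rV[R]_n.
Proof. by apply/rowP => j; rewrite !mxE. Qed.

Lemma freq_delta j : freq (delta_mx ord0 j) = e_ j.
Proof. by apply/rowP => i; rewrite !mxE; case: (_ && _). Qed.

Lemma sinDz (z : int) t : sin (t + 2 * pi * z%:~R) = sin t.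
Proof.
have E (m : nat) (a : R) : sin (a + 2 * pi * m%:R) = sin a.
  rewrite (_ : 2 * pi * m%:R = pi *+ 2 *+ m); last by rewrite -[RHS]mulr_natr -[pi *+ 2]mulr_natl.
  exact: (periodicn (@sinD2pi R)).
case: z => m; first exact: E.
by rewrite -[RHS](E m.+1) -{1}(E m.+1 (t + _)) NegzE mulrNz mulrN subrK E.
Qed.

Lemma dotp_freq k l : dotp (freq k) (freq l) = (\sum_j k ord0 j * l ord0 j)%:~R :> R.
Proof. by rewrite raddf_sum /=; apply: eq_bigr => j _; rewrite !mxE intrM. Qed.

Lemma wave_periodic k t : Defs.periodic (wave k t).
Proof.
by move=> l x; rewrite /wave dotpDr dotpZr dotp_freq addrAC sinDz.
Qed.

Lemma wave_cos k x : wave k (pi / 2) x = cos (dotp (freq k) x).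
Proof. exact: sinDpihalf. Qed.

Lemma wave_shift k t x :
  wave k t x = cos t * wave k 0 x + sin t * wave k (pi / 2) x.
Proof. by rewrite /wave sinD sinDpihalf addr0; ring. Qed.

Lemma continuous_dotp (a : 'rV[R]_n) : continuous (dotp a : 'rV[R]_n -> R).
Proof.
apply: (continuous_Rsum (F := fun j (x : 'rV[R]_n) => a ord0 j * x ord0 j)) => j x.
by apply: continuousM; [exact: cst_continuous|exact: coord_continuous].
Qed.

Lemma wave_continuous k t : continuous (wave k t).
Proof.
move=> x; rewrite (_ : wave k t = sin \o (fun y => dotp (freq k) y + t))//.
apply: continuous_comp; last exact: continuous_sin.
by apply: continuousD; [exact: continuous_dotp|exact: cst_continuous].
Qed.

Lemma is_derive_wave (c : R) k t x (j : 'I_n) :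
  is_derive x (e_ j) (fun y => c * wave k t y)
    (c * freq k ord0 j * wave k (t + pi / 2) x).
Proof.
pose a := freq k ord0 j : R; pose b := dotp (freq k) x + t.
pose G (s : R) := c * sin (s * a + b).
have dG : is_derive (0 : R) 1 G (c * (cos b * a)).
  have d1 : is_derive (0 : R) 1 (fun s : R => s * a + b) a.
    have -> : (fun s : R => s * a + b) = (fun s : R => a *: s) + cst b.
      by apply/funext => s; exact: (congr1 (+%R^~ b) (mulrC s a)).
    by apply: is_derive_eq; rewrite addr0 [a *: _]mulr1.
  have d2 : is_derive (0 : R) 1 (sin \o (fun s : R => s * a + b)) (cos b * a).
    by apply: is_derive1_comp; rewrite mul0r add0r; exact: is_derive_sin.
  by have := is_deriveZ c d2.
have E : (fun h : R => h^-1 *: ((fun y => c * wave k t y) (h *: e_ j + x) - c * wave k t x)) =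
    (fun h : R => h^-1 *: (G (h *: 1 + 0) - G 0)).
  apply/funext => h; rewrite /G mul0r add0r addr0 [h *: 1]mulr1 /wave dotpDr dotpZr.
  by rewrite [dotp (freq k) (e_ j)]dotpC dotp_delta /b /a addrA.
have [dG1 dG2] := dG.
apply: DeriveDef; first by rewrite /derivable E.
rewrite /derive E -/(derive G 0 1) dG2 /wave addrA sinDpihalf -/b -/a; ring.
Qed.

Lemma partial_wave (c : R) k t (j : 'I_n) :
  partial j (fun y => c * wave k t y) =
  (fun y => c * freq k ord0 j * wave k (t + pi / 2) y).
Proof. by apply/funext => x; have [] := is_derive_wave c k t x j. Qed.

Lemma partial_wave1 k t (j : 'I_n) :
  partial j (wave k t) = fun y => freq k ord0 j * wave k (t + pi / 2) y.
Proof.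
rewrite -[wave k t in LHS](_ : (fun y => 1 * wave k t y) = _).
  by rewrite partial_wave; apply/funext => y; rewrite mul1r.
by apply/funext => y; rewrite mul1r.
Qed.

Lemma wave_test k t : test_function (wave k t).
Proof.
split; last exact: wave_periodic.
move=> s; have [c [t' ->]] : exists c t', foldr (@partial R n) (wave k t) s = fun x => c * wave k t' x.
  elim: s => [|j s [c [t' IH]]] /=.
    by exists 1, t; apply/funext => x; rewrite mul1r.
  by exists (c * freq k ord0 j), (t' + pi / 2); rewrite IH partial_wave.
split=> [x|j x]; first by apply: continuousM; [exact: cst_continuous|exact: wave_continuous].
by have [] := is_derive_wave c k t' x j.
Qed.

Lemma periodic_upd (T : Type) (f : 'rV[R]_n -> T) (j : 'I_n) x : Defs.periodic f ->
  f (upd j x pi) = f (upd j x (- pi)).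
Proof.
move=> /(_ (delta_mx ord0 j) (upd j x (- pi))) <-; congr f.
by rewrite freq_delta addrC -updDr; congr upd; ring.
Qed.

(** Integration by parts: the derivative of [phi * wave k t] has mean 0. *)
Lemma integral_partial_mul_wave (phi : 'rV[R]_n -> R) (j : 'I_n) k t :
  test_function phi ->
  \int[leb R n]_(x in cell R n) (partial j phi x * wave k t x) =
  - (freq k ord0 j * \int[leb R n]_(x in cell R n) (phi x * wave k (t + pi / 2) x)).
Proof.
move=> [sm per].
have [cphi dphi] := sm [::]; have [cpphi _] := sm [:: j].
have dw x : derivable (wave k t) x (e_ j) by have [_ /(_ [::])[]] := conj I (proj1 (wave_test k t)).
have dE x : partial j (phi * wave k t) x =
    partial j phi x * wave k t x + freq k ord0 j * (phi x * wave k (t + pi / 2) x).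
  rewrite /partial deriveM//= -/(partial j (wave k t) x).
  rewrite partial_wave1 -/(partial j phi x) addrC; congr (_ + _); first exact: mulrC.
  exact: mulrCA.
have c1 : continuous (fun x : 'rV[R]_n => partial j phi x * wave k t x).
  by move=> x; apply: continuousM; [exact: cpphi|exact: wave_continuous].
have c2 : continuous (fun x : 'rV[R]_n => phi x * wave k (t + pi / 2) x).
  by move=> x; apply: continuousM; [exact: cphi|exact: wave_continuous].
have c2' : continuous (fun x : 'rV[R]_n => (freq k ord0 j : R) * (phi x * wave k (t + pi / 2) x)).
  exact: continuous_Rscale.
apply/eqP; rewrite -addr_eq0; apply/eqP.
rewrite -RintegralZl; [|exact: measurable_cell|exact: cell_integrable].
rewrite -RintegralD//; [|exact: measurable_cell|exact: cell_integrable|exact: cell_integrable].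
transitivity (\int[leb R n]_(x in cell R n) partial j (phi * wave k t) x).
  by apply: eq_Rintegral => x _; rewrite dE.
apply: integral_partial_cell.
- by move=> x; apply: continuousM; [exact: cphi|exact: wave_continuous].
- by move=> x; apply: derivableM.
- rewrite (_ : partial j _ = fun x => partial j phi x * wave k t x +
     freq k ord0 j * (phi x * wave k (t + pi / 2) x)); last exact/funext.
  exact: continuous_Radd.
- move=> x; congr (_ * _); first exact: periodic_upd.
  by apply: periodic_upd; exact: wave_periodic.
Qed.

(** Such a wave is the derivative of a periodic function, in any direction [j]
    with [k_j] nonzero. *)
Lemma integral_wave_neq0 k t : k != 0 ->
  \int[leb R n]_(x in cell R n) wave k t x = 0.
Proof.
move=> k0; have [j kj] : exists j, k ord0 j != 0.
  apply/existsP; apply: contraNT k0 => /existsPn k0; apply/eqP/rowP => j.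
  by rewrite mxE; apply/eqP/negPn/k0.
have fj0 : freq k ord0 j != 0 :> R by rewrite mxE intr_eq0.
rewrite (_ : wave k t = partial j (fun x => (freq k ord0 j)^-1 * wave k (t - pi / 2) x)).
  apply: integral_partial_cell.
  - by apply: continuous_Rscale; exact: wave_continuous.
  - by move=> x; have [] := is_derive_wave (freq k ord0 j)^-1 k (t - pi / 2) x j.
  - by rewrite partial_wave; apply: continuous_Rscale; exact: wave_continuous.
  - by move=> x; congr (_ * _); apply: periodic_upd; exact: wave_periodic.
by rewrite partial_wave subrK; apply/funext => x; rewrite mulVf// mul1r.
Qed.

Lemma integral_wave k t :
  \int[leb R n]_(x in cell R n) wave k t x = (k == 0)%:R * (sin t * (2 * pi) ^+ n).
Proof.
have [->|k0] := eqVneq k 0; last by rewrite integral_wave_neq0// mul0r.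
transitivity (\int[leb R n]_(x in cell R n) cst (sin t) x).
  by apply: eq_Rintegral => x _; rewrite /wave freq0 dotp0l add0r.
rewrite Rintegral_cst; last exact: measurable_cell.
by rewrite [X in fine X]leb_cell mul1r.
Qed.

End waves.

(** * Fejer means *)

Section fejer.
Context (R : realType) (n N : nat).
Implicit Types (x y z : 'rV[R]_n).
Local Notation idx := {ffun 'I_n -> 'I_N.+1}.
Local Notation V := ((2 * pi) ^+ n : R).

Definition idx_freq (m : idx) : 'rV[int]_n := \row_j (m j : nat)%:Z.
Definition fejer_freq (p : idx * idx) : 'rV[int]_n := idx_freq p.1 - idx_freq p.2.
Definition fejer_cst : R := (V * #|{: idx}|%:R)^-1.
(** The [n]-dimensional Fejer kernel: a normalization of the square of the
    modulus of the sum of [exp (i m . z)] over the [m] in [{0, .., N}^n].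
    Expanding the square yields a sum over pairs of such [m]. *)
Definition fejer z : R := fejer_cst * \sum_p cos (dotp (freq (fejer_freq p)) z).

Let V0 : 0 < V. Proof. by rewrite exprn_gt0// mulr_gt0// pi_gt0. Qed.

Let idx0 : (0 < #|{: idx}|%:R :> R).
Proof. by rewrite ltr0n; apply/card_gt0P; exists [ffun=> ord0]. Qed.

Lemma fejer_cst_gt0 : 0 < fejer_cst.
Proof. by rewrite invr_gt0 mulr_gt0. Qed.

Lemma fejer_ge0 z : 0 <= fejer z.
Proof.
apply: mulr_ge0; first exact: ltW fejer_cst_gt0.
pose c (m : idx) : R := cos (dotp (freq (idx_freq m)) z).
pose s (m : idx) : R := sin (dotp (freq (idx_freq m)) z).
rewrite (_ : \sum_p _ = (\sum_m c m) ^+ 2 + (\sum_m s m) ^+ 2).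
  by rewrite addr_ge0// sqr_ge0.
rewrite !expr2 !big_distrlr /= !pair_big -big_split /=.
by apply: eq_bigr => -[m m'] _; rewrite freqD freqN dotpDl dotpNl cosB.
Qed.

Let cos_wave (k : 'rV[int]_n) x y :
  cos (dotp (freq k) (x - y)) = wave k (pi / 2 - dotp (freq k) x) y.
Proof.
rewrite /wave addrCA addrC sinDpihalf -cosN; congr cos.
by rewrite dotpDr -[- y]scaleN1r dotpZr; ring.
Qed.

Lemma continuous_cos_shift (k : 'rV[int]_n) x :
  continuous (fun y => cos (dotp (freq k) (x - y))).
Proof.
rewrite (_ : (fun y => _) = wave k (pi / 2 - dotp (freq k) x)).
  exact: wave_continuous.
by apply/funext => y; rewrite cos_wave.
Qed.

Lemma integral_cos_shift (k : 'rV[int]_n) x :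
  \int[leb R n]_(y in cell R n) cos (dotp (freq k) (x - y)) = (k == 0)%:R * V.
Proof.
under eq_Rintegral do rewrite cos_wave.
rewrite integral_wave; have [->|_] := eqVneq k 0; last by rewrite !mul0r.
by rewrite freq0 dotp0l subr0 sin_pihalf ?mul1r ?mulr1.
Qed.

Lemma continuous_fejer x : continuous (fun y => fejer (x - y)).
Proof.
apply: continuous_Rscale; apply: continuous_Rsum => p; exact: continuous_cos_shift.
Qed.

Lemma idx_freq_inj : injective idx_freq.
Proof.
move=> m m' /rowP E; apply/ffunP => j; have := E j; rewrite !mxE => -[] E'.
exact: val_inj.
Qed.

Lemma integral_fejer x : \int[leb R n]_(y in cell R n) fejer (x - y) = 1.
Proof.
have cc := continuous_cos_shift.
rewrite RintegralZl; [|exact: measurable_cell|]; last first.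
  by apply: cell_integrable; apply: continuous_Rsum => p.
rewrite Rintegral_sum; [|exact: measurable_cell|by move=> p; exact: cell_integrable].
under eq_bigr do rewrite integral_cos_shift.
rewrite -mulr_suml (_ : \sum_p _ = #|{: idx}|%:R); last first.
  rewrite -(pair_bigA _ (fun m m' => (fejer_freq (m, m') == 0)%:R)) /=.
  rewrite -sum1_card natr_sum; apply: eq_bigr => m _.
  rewrite (bigD1 m)//= /fejer_freq subrr eqxx big1 ?addr0// => m' mm'.
  by rewrite subr_eq0 (inj_eq idx_freq_inj) eq_sym (negbTE mm').
by rewrite /fejer_cst [_ * V]mulrC mulVf// mulf_neq0// gt_eqF.
Qed.

(** A fraction [N / N.+1] of the cube [{0, .., N}^n] has its [i]-th coordinate
    different from [N]. *)
Let idx_count (i : 'I_n) : (\sum_(m : idx) (m i < N)%:R) * N.+1%:R = N%:R * #|{: idx}|%:R :> R.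
Proof.
pose F (j : 'I_n) (c : 'I_N.+1) : R := if j == i then (c < N)%:R else 1.
have E (m : idx) : (m i < N)%:R = \prod_j F j (m j).
  rewrite (bigD1 i)//= /F eqxx big1 ?mulr1// => j /negbTE ->; by [].
under eq_bigr do rewrite E.
rewrite -(bigA_distr_bigA F) (bigD1 i)//=.
rewrite {1}/F eqxx big_ord_recr /= ltnn addr0.
under [X in X * _ * _]eq_bigr => c _ do rewrite ltn_ord.
rewrite sumr_const card_ord -mulrA; congr (_ * _).
rewrite card_ffun !card_ord.
rewrite (eq_bigr (fun=> N.+1%:R)); last first.
  by move=> j /negbTE ji; rewrite /F ji sumr_const card_ord.
rewrite prodr_const cardC1 card_ord -natrX -natrM -expnSr.
by case: n i {F E} => [[]//|n' i]; rewrite /= .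
Qed.

(** The pairs at distance [e_i] are obtained by shifting the points of the cube
    that do not lie on its [i]-th far face. *)
Let shift_count (i : 'I_n) : \sum_p (fejer_freq p == delta_mx ord0 i)%:R =
  N%:R * #|{: idx}|%:R / N.+1%:R :> R.
Proof.
rewrite -(idx_count i) mulfK ?pnatr_eq0//.
rewrite -(pair_bigA _ (fun m m' => (fejer_freq (m, m') == delta_mx ord0 i)%:R)) /=.
rewrite exchange_big /=; apply: eq_bigr => m' _.
case: ltnP => mN.
  pose m : idx := [ffun j => if j == i then inord (m' j).+1 else m' j].
  have mE : fejer_freq (m, m') == delta_mx ord0 i.
    apply/eqP/rowP => j; rewrite !mxE /= ffunE; case: eqP => [->|_] /=; last by rewrite subrr.
    by rewrite inordK// -addn1 PoszD addrAC subrr add0r.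
  rewrite (bigD1 m)//= mE big1 ?addr0// => m1 m1m.
  rewrite (_ : (_ == _) = false)//; apply: contra_neqF m1m => /eqP E.
  apply: idx_freq_inj; apply: (addIr (- idx_freq m')).
  exact: etrans E (esym (eqP mE)).
rewrite big1// => m _; rewrite (_ : (_ == _) = false)//.
apply/negP => /eqP/rowP/(_ i); rewrite !mxE !eqxx /=.
have := ltn_ord (m i); rewrite ltnS => mi E.
move/eqP: E; rewrite subr_eq => /eqP [] E.
by move: mi; rewrite E add1n ltnNge mN.
Qed.

(** Multiplying by the cosine shifts the frequencies by [e_i] and [- e_i], and
    only the vanishing frequencies have a nonzero mean. *)
Lemma integral_fejer_cos (i : 'I_n) x :
  \int[leb R n]_(y in cell R n) (fejer (x - y) * cos (x ord0 i - y ord0 i)) =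
  N%:R / N.+1%:R.
Proof.
pose e : 'rV[int]_n := delta_mx ord0 i.
have cc := continuous_cos_shift.
have fE y : fejer (x - y) * cos (x ord0 i - y ord0 i) = fejer_cst * (2^-1 * (\sum_p
    (cos (dotp (freq (fejer_freq p + e)) (x - y)) +
     cos (dotp (freq (fejer_freq p - e)) (x - y))))).
  rewrite /fejer -mulrA; congr (_ * _); rewrite mulr_suml mulr_sumr; apply: eq_bigr => p _.
  have eE : dotp (freq e) (x - y) = x ord0 i - y ord0 i.
    by rewrite freq_delta dotp_delta !mxE.
  rewrite (freqD _ _ e) (freqD _ _ (- e)) (freqN _ e) !dotpDl dotpNl eE.
  by set B := x ord0 i - y ord0 i; set A := dotp _ _; rewrite cosB cosD; field.
under eq_Rintegral do rewrite fE.
have c2 : continuous (fun y => \sum_p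
    (cos (dotp (freq (fejer_freq p + e)) (x - y)) +
     cos (dotp (freq (fejer_freq p - e)) (x - y)))).
  by apply: continuous_Rsum => p; exact: continuous_Radd.
have c3 := continuous_Rscale (c := 2^-1) c2.
rewrite RintegralZl; [|exact: measurable_cell|exact: cell_integrable].
rewrite RintegralZl; [|exact: measurable_cell|exact: cell_integrable].
rewrite Rintegral_sum; [|exact: measurable_cell|]; last first.
  by move=> p; apply: cell_integrable; exact: continuous_Radd.
under eq_bigr => p _.
  rewrite RintegralD; [|exact: measurable_cell|exact: cell_integrable|exact: cell_integrable].
  rewrite !integral_cos_shift -mulrDl; over.
rewrite -mulr_suml big_split /=.
have E1 : \sum_p (fejer_freq p - e == 0)%:R = N%:R * #|{: idx}|%:R / N.+1%:R :> R.
  by rewrite -(shift_count i); apply: eq_bigr => p _; rewrite subr_eq0.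
have E2 : \sum_p (fejer_freq p + e == 0)%:R = N%:R * #|{: idx}|%:R / N.+1%:R :> R.
  rewrite -(shift_count i) (reindex_inj (h := fun p : idx * idx => (p.2, p.1))) /=; last first.
    by move=> [? ?] [? ?] [-> ->].
  apply: eq_bigr => -[m m'] _ /=; congr (nat_of_bool _)%:R.
  by rewrite /fejer_freq /= addr_eq0 -(inj_eq oppr_inj) opprB opprK.
rewrite E1 E2 /fejer_cst; field.
by rewrite nat1r pnatr_eq0 (gt_eqF idx0) (gt_eqF V0).
Qed.

End fejer.

Section fejer_approximation.
Context (R : realType) (n : nat).
Implicit Types (x y z : 'rV[R]_n).

Lemma cos_close (eta t : R) : 0 < eta <= pi -> cos eta < cos t ->
  exists k : int, `|t - 2 * pi * k%:~R| < eta.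
Proof.
move=> /andP[e0 epi] ct; pose P : R := 2 * pi.
have P0 : 0 < P by rewrite mulr_gt0// pi_gt0.
(* This [k] brings [t - 2 * pi * k] into [-pi, pi[. *)
pose k := Num.floor ((t + pi) / P); exists k.
have := floor_itv ((t + pi) / P); rewrite -/k ler_pdivlMr// ltr_pdivrMr// => /andP[k1 k2].
pose s := t - P * k%:~R; rewrite -[t - _]/s.
have cs : cos `|s| = cos t.
  have c2 (a : R) (z : int) : cos (a + 2 * pi * z%:~R) = cos a.
    by rewrite -!sinDpihalf addrAC sinDz.
  have -> : cos `|s| = cos s by case: (ler0P s) => _; rewrite ?cosN.
  by rewrite -(c2 s k) /s subrK.
have spi : `|s| <= pi.
  rewrite ler_norml; move: k1 k2; rewrite intrD /s /P; set p := pi; set kk := k%:~R => k1 k2.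
  by apply/andP; split; lra.
by rewrite -(ltr_cos (R := R)) ?in_itv/= ?normr_ge0 ?spi ?(ltW e0) ?epi ?cs.
Qed.

(** Continuity at [x] stated through cosines, so that it holds for [y] in the
    whole space: [y] is close to [x] modulo the periods. *)
Lemma periodic_local (g : 'rV[R]_n -> R) x e : continuous g -> Defs.periodic g -> 0 < e ->
  exists2 eta : R, 0 < eta <= pi & forall y,
    (forall i, cos eta < cos (x ord0 i - y ord0 i)) -> `|g y - g x| <= e.
Proof.
move=> cg pg e0.
have /cvgrPdist_lt /(_ _ e0) /nbhs_ballP [d /= d0 hd] := cg x.
exists (Num.min d pi); first by rewrite lt_min d0 pi_gt0 ge_min lexx orbT.
move=> y cy.
have eta0 : 0 < Num.min d pi <= pi by rewrite lt_min d0 pi_gt0 ge_min lexx orbT.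
have /choice[k hk] := fun i => cos_close eta0 (cy i).
rewrite -(pg (\row_i k i) y) distrC ltW//.
apply: hd; split => // i j; rewrite (ord1 i) /ball/= !mxE opprD addrA.
by apply: lt_le_trans (hk j) _; rewrite ge_min lexx.
Qed.

Definition fejer_mean N (g : 'rV[R]_n -> R) x : R :=
  \int[leb R n]_(y in cell R n) (g y * fejer N (x - y)).

Lemma fejer_mean_bound N (g : 'rV[R]_n -> R) M x : continuous g ->
  (forall y, cell R n y -> `|g y| <= M) -> `|fejer_mean N g x| <= M.
Proof.
move=> cg gM; have cf := @continuous_fejer R n N x.
have cgf := continuous_Rmul cg cf.
have mc := measurable_cell R n.
rewrite (le_trans (le_normr_Rintegral mc (cell_integrable cgf)))//.
rewrite -[leRHS]mulr1 -(integral_fejer N x) -RintegralZl//; last exact: cell_integrable.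
apply: le_Rintegral => //.
- by apply: cell_integrable; exact: continuous_Rnorm.
- by apply: cell_integrable; exact: continuous_Rscale.
by move=> y cy; rewrite normrM (ger0_norm (fejer_ge0 _ _)) ler_wpM2r ?fejer_ge0 ?gM.
Qed.

(** The bound on [`|g y - g x|] is integrated against the kernel, whose integral
    is 1 and whose integral against [1 - cos (x_i - y_i)] is [1 / N.+1]. *)
Lemma fejer_mean_close N (g : 'rV[R]_n -> R) x (e D : R) : continuous g ->
  (forall y, cell R n y -> `|g y - g x| <= e + D * \sum_i (1 - cos (x ord0 i - y ord0 i))) ->
  `|fejer_mean N g x - g x| <= e + D * n%:R / N.+1%:R.
Proof.
move=> cg gD; have cf := @continuous_fejer R n N x.
have mc := measurable_cell R n.
have cgx : continuous (fun y => g y - g x).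
  by apply: continuous_Radd => //; exact: cst_continuous.
have cgf := continuous_Rmul cg cf.
have cgxf := continuous_Rmul cgx cf.
have ccos i : continuous (fun y => cos (x ord0 i - y ord0 i)).
  have := @continuous_cos_shift R n (delta_mx ord0 i) x.
  by under eq_fun do rewrite freq_delta dotp_delta !mxE.
have cfc i := continuous_Rmul cf (ccos i).
have cD i : continuous (fun y => fejer N (x - y) - fejer N (x - y) * cos (x ord0 i - y ord0 i)).
  exact: continuous_Rsub.
have cS := continuous_Rsum (s := index_enum 'I_n) cD.
have cDS := continuous_Rscale (c := D) cS.
have cef := continuous_Rscale (c := e) cf.
have -> : fejer_mean N g x - g x =
    \int[leb R n]_(y in cell R n) ((g y - g x) * fejer N (x - y)).
  under [RHS]eq_Rintegral do rewrite mulrBl.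
  rewrite RintegralB//; [|exact: cell_integrable|]; last first.
    by apply: cell_integrable; exact: continuous_Rscale.
  by rewrite RintegralZl ?integral_fejer ?mulr1//; exact: cell_integrable.
rewrite (le_trans (le_normr_Rintegral mc (cell_integrable cgxf)))//.
have -> : e + D * n%:R / N.+1%:R = \int[leb R n]_(y in cell R n) (e * fejer N (x - y) +
   D * \sum_i (fejer N (x - y) - fejer N (x - y) * cos (x ord0 i - y ord0 i))).
  rewrite RintegralD//; [|exact: cell_integrable|exact: cell_integrable].
  rewrite RintegralZl ?integral_fejer ?mulr1//; last exact: cell_integrable.
  rewrite RintegralZl//; last exact: cell_integrable.
  rewrite Rintegral_sum//; last by move=> i; exact: cell_integrable.
  under eq_bigr => i _.
    rewrite RintegralB//; [|exact: cell_integrable|exact: cell_integrable].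
    rewrite integral_fejer integral_fejer_cos; over.
  rewrite sumr_const card_ord -mulrA -[X in _ = _ + _ * X]mulr_natl; congr (_ + _ * (_ * _)).
  by rewrite -[in RHS]natr1; field; rewrite natr1 pnatr_eq0.
apply: le_Rintegral => //.
- by apply: cell_integrable; exact: continuous_Rnorm.
- by apply: cell_integrable; exact: continuous_Radd.
move=> y cy; rewrite normrM (ger0_norm (fejer_ge0 _ _)).
apply: le_trans (ler_wpM2r (fejer_ge0 _ _) (gD y cy)) _.
rewrite mulrDl le_eqVlt; apply/orP; left; apply/eqP; congr (_ + _).
rewrite -mulrA mulr_suml; congr (_ * _); apply: eq_bigr => i _; by ring.
Qed.

(** Where some [x_i - y_i] is far from the periods, the bound [2 * M] on the
    oscillation of [g] is absorbed by [D * (1 - cos (x_i - y_i))]. *)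
Lemma fejer_mean_cvg (g : 'rV[R]_n -> R) x : continuous g -> Defs.periodic g ->
  cell R n x -> fejer_mean N g x @[N --> \oo] --> g x.
Proof.
move=> cg pg cx; apply/cvgrPdist_le => e e0.
have [M M0 gM] := cell_bounded cg.
have e20 : 0 < e / 2 by rewrite divr_gt0.
have [eta eta0 geta] := periodic_local x cg pg e20.
have ce : 0 < 1 - cos eta.
  rewrite subr_gt0 -cos0 ltr_cos ?in_itv/= ?lexx ?pi_ge0//; by case/andP: eta0 => // /ltW ->.
pose D := 2 * M / (1 - cos eta).
have D0 : 0 <= D by rewrite divr_ge0 ?mulr_ge0 ?ltW.
have key N : `|fejer_mean N g x - g x| <= e / 2 + D * n%:R / N.+1%:R.
  apply: fejer_mean_close => // y cy.
  have c1 i : 0 <= 1 - cos (x ord0 i - y ord0 i) by rewrite subr_ge0 cos_le1.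
  have [all|] := pselect (forall i, cos eta < cos (x ord0 i - y ord0 i)).
    by rewrite (le_trans (geta y all))// lerDl mulr_ge0// sumr_ge0.
  move=> /existsNP[i /negP]; rewrite -leNgt => ci.
  rewrite (@le_trans _ _ (2 * M))//.
    rewrite (le_trans (ler_normB _ _))// mulrDl mul1r lerD ?gM//; exact: cell_closed.
  rewrite -[leLHS]add0r lerD ?(ltW e20)//.
  rewrite -[leLHS](divfK (lt0r_neq0 ce)) -/D ler_wpM2l//.
  by rewrite (bigD1 i)//= ler_wpDr ?sumr_ge0 ?lerB.
have e2 : e = e / 2 + e / 2 by field.
have C0 : 0 < D * n%:R + 1 by rewrite ltr_wpDl// mulr_ge0.
near=> N; rewrite distrC (le_trans (key N))//.
rewrite [leRHS]e2 lerD2l.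
have Ne : N.+1%:R^-1 < e / 2 / (D * n%:R + 1).
  by near: N; exact: near_infty_natSinv_lt (PosNum (divr_gt0 e20 C0)).
rewrite ltr_pdivlMr// in Ne; apply: le_trans (ltW Ne).
by rewrite mulrC ler_wpM2l// lerDl.
Unshelve. all: by end_near.
Qed.

(** A Fejer mean is a trigonometric polynomial whose coefficients are, up to the
    multipliers, the Fourier coefficients of [g]. *)
Lemma fejer_mean_wave N (g : 'rV[R]_n -> R) x : continuous g ->
  fejer_mean N g x = fejer_cst R n N * \sum_(p : {ffun 'I_n -> 'I_N.+1} * {ffun 'I_n -> 'I_N.+1})
    (wave (fejer_freq p) 0 x *
       \int[leb R n]_(y in cell R n) (g y * wave (fejer_freq p) 0 y) +
     wave (fejer_freq p) (pi / 2) x *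
       \int[leb R n]_(y in cell R n) (g y * wave (fejer_freq p) (pi / 2) y)).
Proof.
move=> cg; have mc := measurable_cell R n.
have cgw k t : continuous (fun y => g y * wave k t y).
  by apply: continuous_Rmul => //; exact: wave_continuous.
pose F (p : {ffun 'I_n -> 'I_N.+1} * {ffun 'I_n -> 'I_N.+1}) y :=
  wave (fejer_freq p) 0 x * (g y * wave (fejer_freq p) 0 y) +
  wave (fejer_freq p) (pi / 2) x * (g y * wave (fejer_freq p) (pi / 2) y).
have cF p : continuous (F p) by apply: continuous_Radd; apply: continuous_Rscale.
have E y : g y * fejer N (x - y) = fejer_cst R n N * \sum_p F p y.
  rewrite /fejer mulrCA; congr (_ * _); rewrite mulr_sumr; apply: eq_bigr => p _.
  rewrite /F !wave_cos /wave !addr0 dotpDr -[- y]scaleN1r dotpZr mulN1r cosB; ring.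
rewrite /fejer_mean; under eq_Rintegral do rewrite E.
rewrite RintegralZl//; last by apply: cell_integrable; exact: continuous_Rsum.
rewrite Rintegral_sum//; last by move=> p; exact: cell_integrable.
congr (_ * _); apply: eq_bigr => p _.
rewrite RintegralD//; [|exact/cell_integrable/continuous_Rscale|exact/cell_integrable/continuous_Rscale].
by rewrite !RintegralZl//; exact: cell_integrable.
Qed.

Lemma fejer_mean_continuous N (g : 'rV[R]_n -> R) : continuous g ->
  continuous (fejer_mean N g).
Proof.
move=> cg; rewrite (funext (fun x => fejer_mean_wave N x cg)).
by apply: continuous_Rscale; apply: continuous_Rsum => p; apply: continuous_Radd;
  apply: continuous_Rmul; (exact: wave_continuous || exact: cst_continuous).
Qed.

End fejer_approximation.

(** * The divergence in Fourier variables *)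

Section divergence_spectral.
Context (R : realType) (n : nat).
Variable u : 'rV[R]_n -> 'rV[R]_n.
Hypothesis hu : periodic_L2 u.
Local Notation mc := (measurable_cell R n).

Lemma periodic_L2_integrable j :
  (leb R n).-integrable (cell R n) (EFin \o (fun x => u x ord0 j)).
Proof.
have [_ /(_ j)[mu_ fin]] := hu.
have m2 : measurable_fun (cell R n) (fun x => ((u x ord0 j) ^+ 2)%:E).
  apply/measurable_EFinP; apply: measurable_funTS; exact: measurable_funX.
have i2 : (leb R n).-integrable (cell R n) (fun x => ((u x ord0 j) ^+ 2)%:E).
  apply/integrableP; split => //; apply: le_lt_trans fin.
  by under eq_integral do rewrite gee0_abs ?lee_fin ?sqr_ge0//.
have := integrableD mc (cell_integrable_cst n (1 : R)) i2.
apply: le_integrable; first exact: mc.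
  by apply/measurable_EFinP; exact: measurable_funTS.
move=> x _ /=; rewrite lee_fin; set a := u x ord0 j.
rewrite [leRHS]ger0_norm ?addr_ge0 ?sqr_ge0//.
(* [`|a| <= 1 + a ^+ 2], and the cell has finite measure. *)
have := sqr_ge0 (`|a| - 1); have := real_normK (num_real a); nra.
Qed.

(** The phases [t = 0] and [t = pi / 2] give the imaginary and the real part of
    the scalar product of [k] with the Fourier coefficient of [u] at [k]. *)
Definition spectral_divfree := forall k t,
  \sum_j freq k ord0 j * \int[leb R n]_(x in cell R n) (u x ord0 j * wave k t x) = 0.

Let integrable_uw j k t :
  (leb R n).-integrable (cell R n) (EFin \o (fun x => u x ord0 j * wave k t x)).
Proof.
by apply: integrable_mul_continuous; [exact: periodic_L2_integrable|exact: wave_continuous].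
Qed.

Let Z k t x := \sum_j freq k ord0 j * (u x ord0 j * wave k t x).

Let integrable_Z k t : (leb R n).-integrable (cell R n) (EFin \o Z k t).
Proof.
apply: integrable_Rsum; first exact: mc.
by move=> j; exact: (integrableZl mc _ (integrable_uw j k t)).
Qed.

Let integral_Z k t : \int[leb R n]_(x in cell R n) Z k t x =
  \sum_j freq k ord0 j * \int[leb R n]_(x in cell R n) (u x ord0 j * wave k t x).
Proof.
rewrite Rintegral_sum; [|exact: mc|].
  by apply: eq_bigr => j _; rewrite RintegralZl; [|exact: mc|exact: integrable_uw].
by move=> j; exact: (integrableZl mc _ (integrable_uw j k t)).
Qed.

Lemma divfree_spectral : vanishes (divergence u) -> spectral_divfree.
Proof.
move=> div0 k t; rewrite -integral_Z.
have := div0 _ (wave_test k (t - pi / 2)); rewrite /divergence => -[] /eqP.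
rewrite oppr_eq0 => /eqP <-; apply: eq_Rintegral => x _; apply: eq_bigr => j _.
by rewrite partial_wave1 subrK mulrCA.
Qed.

Lemma partial_periodic (phi : 'rV[R]_n -> R) j :
  Defs.periodic phi -> Defs.periodic (partial j phi).
Proof.
move=> per k x; rewrite /partial /derive.
have -> : (fun h : R => h^-1 *: ((phi \o shift (x + (2 * pi) *: freq k)) (h *: delta_mx ord0 j) -
      phi (x + (2 * pi) *: freq k))) =
    (fun h : R => h^-1 *: ((phi \o shift x) (h *: delta_mx ord0 j) - phi x)) => //.
by apply/funext => h /=; rewrite addrA !per.
Qed.

(** The Fourier coefficients of [partial j phi] at [k] are those of [phi], up to
    the phase, multiplied by [k_j]: the sum over [j] reproduces the spectral
    condition at [k]. *)
Lemma integral_fejer_mean_divfree N (phi : 'rV[R]_n -> R) :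
  spectral_divfree -> test_function phi ->
  \int[leb R n]_(x in cell R n)
    (\sum_j u x ord0 j * fejer_mean N (partial j phi) x) = 0.
Proof.
move=> sd tphi; have [sm _] := tphi.
have cp j : continuous (partial j phi) by have [] := sm [:: j].
pose B k t := \int[leb R n]_(x in cell R n) (phi x * wave k (t + pi / 2) x).
pose I := ({ffun 'I_n -> 'I_N.+1} * {ffun 'I_n -> 'I_N.+1})%type.
pose W (p : I) x :=
  - B (fejer_freq p) 0 * Z (fejer_freq p) 0 x +
  - B (fejer_freq p) (pi / 2) * Z (fejer_freq p) (pi / 2) x.
have iW p : (leb R n).-integrable (cell R n) (EFin \o W p).
  exact: (integrableD mc (integrableZl mc (- B (fejer_freq p) 0) (integrable_Z (fejer_freq p) 0))
    (integrableZl mc (- B (fejer_freq p) (pi / 2)) (integrable_Z (fejer_freq p) (pi / 2)))).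
have E x : \sum_j u x ord0 j * fejer_mean N (partial j phi) x =
    fejer_cst R n N * \sum_(p : I) W p x.
  under eq_bigr => j _.
    rewrite fejer_mean_wave// mulrCA mulr_sumr.
    under eq_bigr => p _ do rewrite !integral_partial_mul_wave// -/(B _ _) -/(B _ _).
    over.
  rewrite -mulr_sumr exchange_big /=; congr (_ * _); apply: eq_bigr => p _.
  rewrite /W /Z !mulr_sumr -big_split /=; apply: eq_bigr => j _; ring.
under eq_Rintegral do rewrite E.
rewrite RintegralZl; [|exact: mc|by apply: integrable_Rsum; [exact: mc|]].
rewrite Rintegral_sum; [|exact: mc|exact: iW].
rewrite big1 ?mulr0// => p _.
rewrite RintegralD; [|exact: mc|exact: (integrableZl mc _ (integrable_Z _ _))|
  exact: (integrableZl mc _ (integrable_Z _ _))].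
rewrite !RintegralZl; [|exact: mc|exact: integrable_Z|exact: mc|exact: integrable_Z].
by rewrite !integral_Z !sd !mulr0 addr0.
Qed.

(** Dominated convergence of the Fejer means, with a bound independent of [N]
    because the Fejer kernel is nonnegative of integral 1. *)
Lemma spectral_divergence : spectral_divfree -> vanishes (divergence u).
Proof.
move=> sd phi tphi; have [sm per] := tphi.
have cp j : continuous (partial j phi) by have [] := sm [:: j].
have cF N j : continuous (fejer_mean N (partial j phi)) by exact: fejer_mean_continuous.
have /choice[M HM] : forall j, exists M : R, forall x, cell R n x -> `|partial j phi x| <= M.
  move=> j; have [M _ HM] := cell_bounded (cp j); exists M => x cx.
  exact/HM/cell_closed.
suff H : \int[leb R n]_(x in cell R n) (\sum_j u x ord0 j * partial j phi x) = 0.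
  by rewrite /divergence H oppr0.
have iu j := periodic_L2_integrable j.
have muj j : measurable_fun (cell R n) (fun x => u x ord0 j).
  by apply/measurable_EFinP; exact: measurable_int (iu j).
pose f_ N x := (\sum_j u x ord0 j * fejer_mean N (partial j phi) x)%:E.
pose f x := (\sum_j u x ord0 j * partial j phi x)%:E.
pose g x := (\sum_j M j * `|u x ord0 j|)%:E.
have mf_ N : measurable_fun (cell R n) (f_ N).
  apply/measurable_EFinP; apply: measurable_sum => j; apply: measurable_funM => //.
  by apply: measurable_funTS; exact: continuous_rV_measurable.
have ig : (leb R n).-integrable (cell R n) g.
  rewrite (_ : g = EFin \o (fun x => \sum_j M j * `|u x ord0 j|))//.
  apply: integrable_Rsum; first exact: mc.
  move=> j; exact: (integrableZl mc (M j) (integrable_norm (iu j))).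
have f_f x : cell R n x -> f_ N x @[N --> \oo] --> f x.
  move=> cx; apply: cvg_EFin; first by near=> N.
  apply: cvg_big => [|j _]; first exact: add_continuous.
  apply: cvgM; first exact: cvg_cst.
  by apply: fejer_mean_cvg => //; exact: partial_periodic.
have f_g N x : cell R n x -> (`|f_ N x| <= g x)%E.
  move=> cx; rewrite lee_fin (le_trans (ler_norm_sum _ _ _))// ler_sum// => j _.
  rewrite normrM mulrC ler_wpM2r//; apply: fejer_mean_bound => //; exact: HM.
have gfin x : cell R n x -> g x \is a fin_num by [].
have cvg := dominated_cvg mc mf_ f_f gfin ig f_g.
have f0 N : (\int[leb R n]_(x in cell R n) f_ N x = 0)%E.
  have if_ : (leb R n).-integrable (cell R n) (f_ N).
    have := ig; apply: le_integrable; [exact: mc|exact: mf_|move=> x cx].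
    by rewrite [leRHS]gee0_abs ?f_g// (le_trans _ (f_g N x cx)).
  rewrite -[LHS]fineK; last exact: (integrable_fin_num mc if_).
  by congr EFin; exact: integral_fejer_mean_divfree.
rewrite /Rintegral -/f (_ : (\int[leb R n]_(x in cell R n) f x)%E = 0%E)//.
rewrite (funext f0) in cvg.
by apply: (cvg_unique _ cvg); [exact: ereal_hausdorff|exact: cvg_cst].
Unshelve. all: by end_near.
Qed.

End divergence_spectral.

(** * The nonlocal divergence in Fourier variables *)

Section fourier.
Context (R : realType) (n : nat).
Local Open Scope complex_scope.
Local Notation mc := (measurable_cell R n).
Local Notation V := ((2 * pi) ^+ n : R).

Lemma fourierE (g : 'rV[R]_n -> R) xi :
  (leb R n).-integrable (cell R n) (EFin \o g) ->
  fourier g xi = (\int[leb R n]_(x in cell R n) (g x * wave xi (pi / 2) x)) +i*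
    (- \int[leb R n]_(x in cell R n) (g x * wave xi 0 x)).
Proof.
move=> ig; have igw := integrable_mul_continuous ig (@wave_continuous R n xi 0).
rewrite /fourier /cintegral; congr (_ +i* _).
  apply: eq_Rintegral => x _; rewrite wave_cos /cis /=.
  by rewrite cosN mul0r subr0.
rewrite -mulN1r -RintegralZl; [|exact: mc|exact: igw].
apply: eq_Rintegral => x _; rewrite /wave addr0 /cis /=.
by rewrite sinN mul0r addr0; ring.
Qed.

Lemma integral_wave_mul (k l : 'rV[int]_n) (t s : R) :
  \int[leb R n]_(x in cell R n) (wave k t x * wave l s x) =
  V / 2 * ((k == l)%:R * cos (t - s) - (k == - l)%:R * cos (t + s)).
Proof.
have E x : wave k t x * wave l s x =
    2^-1 * (wave (k - l) (t - s + pi / 2) x - wave (k + l) (t + s + pi / 2) x).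
  rewrite /wave !addrA !sinDpihalf !freqD freqN !dotpDl dotpNl.
  set A := dotp (freq k) x; set B := dotp (freq l) x.
  rewrite (_ : A - B + t - s = (A + t) - (B + s)); last by ring.
  rewrite (_ : A + B + t + s = (A + t) + (B + s)); last by ring.
  by move: (A + t) (B + s) => a b; rewrite cosB cosD; field.
under eq_Rintegral do rewrite E.
have cw (k' : 'rV[int]_n) t' := cell_integrable (@wave_continuous R n k' t').
rewrite RintegralZl; [|exact: mc|]; last first.
  by apply: cell_integrable; apply: continuous_Rsub; exact: wave_continuous.
rewrite RintegralB; [|exact: mc|exact: cw|exact: cw].
by rewrite !integral_wave !sinDpihalf subr_eq0 addr_eq0; ring.
Qed.

Lemma fourier_wave (xi k : 'rV[int]_n) (t : R) :
  fourier (wave xi t) (- k) =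
  (V / 2 * (((xi == k)%:R + (xi == - k)%:R) * sin t)) +i*
  (V / 2 * (((xi == k)%:R - (xi == - k)%:R) * cos t)).
Proof.
rewrite fourierE; last exact/cell_integrable/wave_continuous.
rewrite !integral_wave_mul opprK subr0 addr0 cosBpihalf cosDpihalf.
by congr (_ +i* _); ring.
Qed.

Let emb N (k : 'rV['I_N.*2.+1]_n) : 'rV[int]_n :=
  map_mx (fun i : 'I_N.*2.+1 => (i : nat)%:Z - N%:Z) k.

Let emb_inj N : injective (@emb N).
Proof.
move=> k l /rowP E; apply/rowP => j; have := E j; rewrite !mxE.
by move=> /addIr [] /val_inj.
Qed.

Let emb_surj N (xi : 'rV[int]_n) : (forall j, `|xi ord0 j| <= N%:Z) ->
  exists k, @emb N k = xi.
Proof.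
move=> xiN; exists (map_mx (fun z : int => inord (absz (z + N%:Z))) xi).
apply/rowP => j; rewrite !mxE; have := xiN j; rewrite ler_norml => /andP[x1 x2].
have x0 : 0 <= xi ord0 j + N%:Z by rewrite -lerBlDr sub0r.
rewrite inordK; first by rewrite gez0_abs// addrK.
rewrite ltnS -lez_nat gez0_abs// -addnn PoszD lerD2r; exact: x2.
Qed.

Lemma box_sum_pair (F : 'rV[int]_n -> R[i]) xi N : xi != 0 ->
  (forall k, k != xi -> k != - xi -> F k = 0) ->
  (forall j, `|xi ord0 j| <= N%:Z) -> box_sum F N = F xi + F (- xi).
Proof.
move=> xi0 F0 xiN.
have xiN' j : `|(- xi) ord0 j| <= N%:Z by rewrite mxE normrN.
have [k1 k1E] := emb_surj xiN; have [k2 k2E] := emb_surj xiN'.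
have k12 : k2 != k1.
  apply: contraNneq xi0 => k12; have : - xi = xi by rewrite -k2E k12.
  move=> /rowP E; apply/eqP/rowP => j; rewrite mxE; have := E j; rewrite mxE => /eqP.
  by rewrite eq_sym -addr_eq0 -mulr2n mulrn_eq0 /= => /eqP.
rewrite /box_sum (bigD1 k1)//= (bigD1 k2)//= -/(@emb N k1) -/(@emb N k2) k1E k2E.
rewrite big1 ?addr0// => k /andP[kk1 kk2]; apply: F0.
  by rewrite -k1E (inj_eq (@emb_inj N)).
by rewrite -k2E (inj_eq (@emb_inj N)).
Qed.

(** The partial sums are constant once the cube contains [xi], so there is no
    question of convergence. *)
Lemma lattice_sum_pair (F : 'rV[int]_n -> R[i]) xi : xi != 0 ->
  (forall k, k != xi -> k != - xi -> F k = 0) ->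
  lattice_sum F = F xi + F (- xi).
Proof.
move=> xi0 F0; pose N0 := (\sum_j absz (xi ord0 j))%N.
have bE N : (N0 <= N)%N -> box_sum F N = F xi + F (- xi).
  move=> NN; apply: box_sum_pair => // j; rewrite -abszE lez_nat (leq_trans _ NN)//.
  by rewrite /N0 (bigD1 j)//= leq_addr.
have L (f : R[i] -> R) : limn (fun N => f (box_sum F N)) = f (F xi + F (- xi)).
  apply: cvg_lim => //; apply: cvg_near_cst; near=> N; congr f; apply: bE.
  by near: N; exact: nbhs_infty_ge.
rewrite /lattice_sum !L; by case: (F xi + _).
Unshelve. all: by end_near.
Qed.

Lemma complex_sum (I : Type) (s : seq I) (a b : I -> R) :
  \sum_(i <- s) (a i +i* b i) = (\sum_(i <- s) a i) +i* (\sum_(i <- s) b i).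
Proof. by elim/big_rec3 : _ => [//|i x y z _ ->]. Qed.

End fourier.

Lemma mul_real_complex (R : realType) (x a b : R) :
  (x%:C * (a +i* b) = (x * a) +i* (x * b))%C.
Proof. by apply/eqP; rewrite eq_complex /= !mul0r subr0 addr0 !eqxx. Qed.

Lemma mul_i_complex (R : realType) (a b : R) :
  ((0 +i* 1) * (a +i* b) = (- b) +i* a)%C.
Proof. by apply/eqP; rewrite eq_complex /= !mul0r !mul1r sub0r add0r !eqxx. Qed.

Section nonlocal_spectral.
Context (R : realType) (n : nat).
Local Open Scope complex_scope.
Variables (omega omega_hat : R -> R) (delta : R).
Hypothesis homega_hat : is_kernel omega_hat.
Hypothesis hK : kernel_assumptions n.+1 omega omega_hat.
Hypothesis delta0 : 0 < delta.
Variable u : 'rV[R]_n.+1 -> 'rV[R]_n.+1.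
Hypothesis hu : periodic_L2 u.
Local Notation V := ((2 * pi) ^+ n.+1 : R).

Let A k t := \sum_j freq k ord0 j *
  \int[leb R n.+1]_(x in cell R n.+1) (u x ord0 j * wave k t x).

Let nonlocal_div_hat0 : nonlocal_div_hat omega_hat delta u 0 = 0.
Proof.
by rewrite /nonlocal_div_hat big1 ?mulr0// => j _; rewrite (b_symbol0 homega_hat delta0) mul0r.
Qed.

Let nonlocal_div_hatE xi : xi != 0 -> exists2 l : R, l != 0 &
  nonlocal_div_hat omega_hat delta u xi = (l * A xi 0) +i* (l * A xi (pi / 2)).
Proof.
move=> xi0; have [l l0 lE] := b_symbol_direction homega_hat hK delta0 xi0.
exists l => //; rewrite /nonlocal_div_hat.
under eq_bigr => j _.
  rewrite fourierE ?lE; last exact: periodic_L2_integrable.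
  rewrite mul_real_complex mulrN -!mulrA.
  over.
rewrite complex_sum sumrN -!mulr_sumr -/(A xi 0) -/(A xi (pi / 2)).
by rewrite mul_i_complex opprK.
Qed.

Lemma spectral_nonlocal : spectral_divfree u ->
  vanishes (nonlocal_div omega_hat delta u).
Proof.
move=> sd phi _; rewrite /nonlocal_div.
have hat0 xi : nonlocal_div_hat omega_hat delta u xi = 0.
  have [->//|xi0] := eqVneq xi 0.
  by have [l _ ->] := nonlocal_div_hatE xi0; rewrite /A !sd !mulr0.
rewrite (_ : lattice_sum _ = 0) ?mulr0//.
have b0 N : box_sum (fun xi => nonlocal_div_hat omega_hat delta u xi * fourier phi (- xi)) N = 0.
  by rewrite /box_sum big1// => k _; rewrite hat0 mul0r.
rewrite /lattice_sum; under eq_fun do rewrite b0.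
under [X in _ +i* limn X]eq_fun do rewrite b0.
by rewrite /= !lim_cst.
Qed.

(** Testing with [wave k (pi / 2)] and with [wave k 0] yields [G k + G (- k) = 0]
    and [G k - G (- k) = 0], where [G] is the Fourier transform of the nonlocal
    divergence. *)
Lemma nonlocal_spectral : vanishes (nonlocal_div omega_hat delta u) ->
  spectral_divfree u.
Proof.
move=> nl k t; have [->|k0] := eqVneq k 0.
  by rewrite big1// => j _; rewrite !mxE mul0r.
have V0 : V != 0 by rewrite expf_neq0// mulf_neq0// gt_eqF// pi_gt0.
have kN : - k != k.
  apply: contraNneq k0 => /rowP E; apply/eqP/rowP => j; rewrite mxE.
  by have := E j; rewrite mxE => /eqP; rewrite eq_sym -addr_eq0 -mulr2n mulrn_eq0 /= => /eqP.
pose G := nonlocal_div_hat omega_hat delta u.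
have pair s : G k * fourier (wave k s) (- k) + G (- k) * fourier (wave k s) (- - k) = 0.
  have := nl _ (wave_test k s); rewrite /nonlocal_div (@lattice_sum_pair _ _ _ k)//; last first.
    move=> l lk lNk; rewrite fourier_wave.
    have -> : (k == l) = false by rewrite eq_sym (negbTE lk).
    have -> : (k == - l) = false.
      by apply: contra_neqF lNk => /eqP ->; rewrite opprK.
    by rewrite addr0 subr0 !mul0r !mulr0.
  move=> /eqP; rewrite mulf_eq0 => /orP[|/eqP //].
  by rewrite eq_complex /= invr_eq0 (negbTE V0).
have kkN : (k == - k) = false by rewrite eq_sym (negbTE kN).
have v0 : V / 2 != 0 by rewrite mulf_neq0// invr_eq0 pnatr_eq0.
have G1 : G k + G (- k) = 0.
  have := pair (pi / 2); rewrite !fourier_wave opprK eqxx kkN cos_pihalf sin_pihalf.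
  rewrite !mulr0 add0r addr0 !mulr1 -mulrDl => /eqP; rewrite mulf_eq0 => /orP[/eqP //|].
  by rewrite eq_complex /= (negbTE v0).
have G2 : G k - G (- k) = 0.
  have := pair 0; rewrite !fourier_wave opprK eqxx kkN cos0 sin0.
  rewrite !mulr0 sub0r subr0 !mulr1 mulrN1.
  rewrite (_ : (0 +i* (- (V / 2))) = - (0 +i* (V / 2))); last first.
    by apply/eqP; rewrite eq_complex /= oppr0 !eqxx.
  rewrite mulrN -mulrBl => /eqP; rewrite mulf_eq0 => /orP[/eqP //|].
  by rewrite eq_complex /= (negbTE v0) andbF.
have G0 : G k = 0.
  have : G k *+ 2 = 0 by rewrite mulr2n -[in X in X + _](subrK (G (- k)) (G k)) G2 add0r addrC.
  by move=> /eqP; rewrite mulrn_eq0 /= => /eqP.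
have [l l0] := nonlocal_div_hatE k0; rewrite -/(G k) G0 => -[/esym/eqP + /esym/eqP].
rewrite !mulf_eq0 (negbTE l0) /= => /eqP A0 /eqP A1.
have iuw j s := integrable_mul_continuous (periodic_L2_integrable hu j) (@wave_continuous R n.+1 k s).
rewrite -[LHS]/(A k t) (_ : A k t = cos t * A k 0 + sin t * A k (pi / 2)); last first.
  rewrite /A !mulr_sumr -big_split /=; apply: eq_bigr => j _.
  rewrite (_ : \int[leb R n.+1]_(x in cell R n.+1) (u x ord0 j * wave k t x) =
    cos t * \int[leb R n.+1]_(x in cell R n.+1) (u x ord0 j * wave k 0 x) +
    sin t * \int[leb R n.+1]_(x in cell R n.+1) (u x ord0 j * wave k (pi / 2) x)); first by ring.
  have mc := measurable_cell R n.+1.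
  rewrite -!RintegralZl; [|exact: mc|exact: iuw|exact: mc|exact: iuw].
  rewrite -RintegralD; [|exact: mc|exact: (integrableZl mc _ (iuw j _))|exact: (integrableZl mc _ (iuw j _))].
  by apply: eq_Rintegral => x _; rewrite wave_shift; ring.
by rewrite A0 A1 !mulr0 addr0.
Qed.

End nonlocal_spectral.

Theorem divfree_nonlocal (R : realType) (n : nat) (omega omega_hat : R -> R) (delta : R)
    (u : 'rV[R]_n.+1 -> 'rV[R]_n.+1) :
  is_kernel omega_hat -> kernel_assumptions n.+1 omega omega_hat -> 0 < delta ->
  periodic_L2 u ->
  vanishes (divergence u) <-> vanishes (nonlocal_div omega_hat delta u).
Proof.
move=> ho hK d0 hu; split.
  by move=> /(divfree_spectral hu); exact: (spectral_nonlocal ho hK d0 hu).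
by move=> /(nonlocal_spectral ho hK d0 hu); exact: spectral_divergence.
Qed.

Theorem corollary8 (R : realType) (d : nat) (hd : d = 2%N \/ d = 3%N)
    (omega omega_hat : R -> R)
    (homega : is_kernel omega) (homega_hat : is_kernel omega_hat)
    (hK : kernel_assumptions d omega omega_hat)
    (delta : R) (hdelta : 0 < delta) :
  [set u : 'rV[R]_d -> 'rV[R]_d |
     periodic_L2 u /\ vanishes (divergence u)] =
  [set u : 'rV[R]_d -> 'rV[R]_d |
     periodic_L2 u /\ vanishes (nonlocal_div omega_hat delta u)].
Proof.
have [n dn] : exists n, d = n.+1 by case: hd => ->; [exists 1%N|exists 2%N].
move: hK; rewrite {}dn in hd * => hK.
apply/seteqP; split => u /= [hu h]; split => //.
  exact/(divfree_nonlocal homega_hat hK hdelta hu).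
exact/(divfree_nonlocal homega_hat hK hdelta hu).
Qed.
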